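(* Let $W\subset GL(V)$, $V=\mathbb{C}^n$, be a complex reflection group, let $m$ be the least common multiple of the orders of the elements of $W$, and let $\sigma\in \mathrm{Gal}(\mathbb{Q}[e^{2\pi i/m}]/\mathbb{Q})$. Let $C=\langle c\rangle$, $C'=\langle c'\rangle$ be cyclic subgroups of $W$ generated by regular elements $c,c'$ having regular eigenvalues $\omega,\omega'$, respectively. Choose an integer $s$ such that $\sigma(\omega)=\omega^s$, and define a left action of $C\times C'$ on the set $W$ by $$(c,c')\,w:=c^s\,w\,(c')^{-1}$$ (so that $(c^i,(c')^j)\,w=c^{si}\,w\,(c')^{-j}$). Then for any integers $i,j$ one has $$W^\sigma(\omega^{-i},(\omega')^{-j})=\left|\{w\in W:(c^i,(c')^j)\,w=w\}\right|.$$
   Context: A complex reflection group is a finite subgroup $W$ of $GL(V)$, $V=\mathbb{C}^n$, generated by reflections (elements whose fixed subspace has codimension $1$). A vector $v\in V$ is regular if it lies on none of the reflecting hyperplanes of reflections in $W$. An element $c\in W$ is regular if it has a regular eigenvector $v$; the eigenvalue $\omega$ with $c(v)=\omega v$ is an accompanying regular eigenvalue. (It is known that $\omega$ has the same multiplicative order as $c$, so that $\omega\in\mathbb{Q}[e^{2\pi i/m}]$.) Coordinates on $V$ are chosen so that the matrix entries of the elements of $W$ lie in $\mathbb{Q}[e^{2\pi i/m}]$; all irreducible complex representations of $W$ can also be realized over this field. $W$ acts on $\mathbb{C}[V]=S(V^* )\cong\mathbb{C}[x_1,\dots,x_n]$ by the action induced from that on $V$; the coinvariant algebra is $A=\mathbb{C}[V]/(\mathbb{C}[V]^W_+)$,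 the quotient by the ideal generated by the invariants of positive degree, with graded pieces $A_i$. For an irreducible complex representation $\lambda$ of $W$ with character $\chi^\lambda$, the fake degree polynomial is $f^\lambda(q)=\sum_{i\ge0} q^i\langle\chi^\lambda, A_i\rangle_W$, where $\langle\cdot,\cdot\rangle_W$ is the inner product (intertwining number) of characters. For a Galois automorphism $\sigma$, $\sigma(\lambda)$ is the irreducible representation obtained by applying $\sigma$ to the matrix entries of $\lambda$, so $\chi^{\sigma(\lambda)}(w)=\sigma(\chi^\lambda(w))$; $\overline{\lambda}$ is the complex conjugate (contragredient) representation. The $\sigma$-bimahonian distribution is $W^\sigma(t,q)=\sum_\lambda f^{\sigma(\lambda)}(t)\,f^{\overline{\lambda}}(q)$, summed over all irreducible complex representations $\lambda$ of $W$. *)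

(* Defs.v *)
From mathcomp Require Export all_boot all_order all_fingroup all_algebra.
From mathcomp Require Export all_solvable mxrepresentation.
From mathcomp Require Export boolp classical_sets functions reals.
From mathcomp Require Export complex mpoly.

Set Implicit Arguments.
Unset Strict Implicit.
Unset Printing Implicit Defensive.

Import GroupScope GRing.Theory Num.Theory.
Local Open Scope ring_scope.

Definition expgz (gT : finGroupType) (x : gT) (k : int) : gT :=
  match k with
  | Posz a => (x ^+ a)%g
  | Negz a => (x ^- a.+1)%g
  end.

(* A finite subgroup W of GL(V), V = C^n, is given as the image of a faithful
   matrix representation rG of an abstract finite group G.  V is the space of
   column vectors, on which g acts on the left by v |-> rG g *m v. *)
Section ReflectionGroup.
Variables (C : numClosedFieldType) (gT : finGroupType) (G : {group gT}).
Variables (n : nat) (rG : mx_representation C G n).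

(* [eigenspace A a] consists of the row vectors u with u *m A = a *: u, so the
   transpose yields the fixed subspace of rG g on column vectors. *)
Definition fixed_dim (g : gT) : nat := \rank (eigenspace (rG g)^T 1).

Definition reflections : {set gT} := [set g in G | (fixed_dim g).+1 == n].

Definition complex_reflection_group : Prop :=
  mx_faithful rG /\ <<reflections>>%g = G.

Definition regular_vector (v : 'cV[C]_n) : Prop :=
  forall g : gT, g \in reflections -> rG g *m v != v.

Definition regular_eigenvalue (c : gT) (omega : C) : Prop :=
  exists v : 'cV[C]_n,
    [/\ v != 0, regular_vector v & rG c *m v = omega *: v].

(* The induced left action on C[V] = S(V^* ): (g f)(v) = f (g^-1 v). *)
Definition poly_act (g : gT) (f : {mpoly C[n]}) : {mpoly C[n]} :=
  f \mPo [tuple \sum_(j < n) rG g^-1%g i j *: 'X_j | i < n].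

(* The invariants lying in the sum of the components of positive degree. *)
Definition positive_invariant (f : {mpoly C[n]}) : Prop :=
  (forall g : gT, g \in G -> poly_act g f = f) /\ f@_0%MM = 0.

Definition coinvariant_ideal : set {mpoly C[n]} :=
  [set f | exists (k : nat) (a b : 'I_k -> {mpoly C[n]}),
     (forall i, positive_invariant (b i)) /\ f = \sum_(i < k) a i * b i]%classic.

(* The classes of e_0, ..., e_(k-1) form a basis of the component of degree d
   of the coinvariant algebra C[V] / coinvariant_ideal. *)
Definition coinvariant_basis (d k : nat) (e : 'I_k -> {mpoly C[n]}) : Prop :=
  [/\ forall i, e i \is d.-homog,
      forall a : 'I_k -> C,
        coinvariant_ideal (\sum_(i < k) a i *: e i) -> forall i, a i = 0
    & forall f : {mpoly C[n]}, f \is d.-homog ->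
        exists a : 'I_k -> C, coinvariant_ideal (f - \sum_(i < k) a i *: e i)].

(* M is the matrix, in such a basis e, of the action of g. *)
Definition coinvariant_matrix (d k : nat) (g : gT) (M : 'M[C]_k) : Prop :=
  exists2 e : 'I_k -> {mpoly C[n]}, coinvariant_basis d e &
    forall j, coinvariant_ideal (poly_act g (e j) - \sum_(i < k) M i j *: e i).

(* The trace of g on the component of degree d; the set is a singleton, since
   that component is finite dimensional and the trace is basis independent. *)
Definition coinvariant_char (d : nat) (g : gT) : C :=
  xget 0 [set x | exists (k : nat) (M : 'M[C]_k),
            coinvariant_matrix d g M /\ x = \tr M]%classic.

Definition char_inner (phi psi : gT -> C) : C :=
  #|G|%:R^-1 * \sum_(g in G) phi g * (psi g)^*.

(* The polynomial with coefficients < chi, A_d >; it exists because the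
   coinvariant algebra is finite dimensional. *)
Definition fake_degree (chi : gT -> C) : {poly C} :=
  xget 0 [set p : {poly C} |
            forall d : nat, p`_d = char_inner chi (coinvariant_char d)]%classic.

(* [DecSocleType (regular_repr C G)] indexes the isomorphism classes of
   irreducible representations of G over C. *)
Definition irr_index := DecSocleType (regular_repr C G).

Definition irr_char (lambda : irr_index) (g : gT) : C :=
  \tr (irr_repr lambda g).

Definition bimahonian (sigma : C -> C) (t q : C) : C :=
  \sum_(lambda : irr_index)
    (fake_degree (fun g => sigma (irr_char lambda g))).[t] *
    (fake_degree (fun g => (irr_char lambda g)^*)).[q].

End ReflectionGroup.

(* Q[zeta], as a subset of C. *)
Definition rat_adjoin (C : numClosedFieldType) (zeta : C) : set C :=
  [set x | exists p : {poly rat}, x = (map_poly ratr p).[zeta]]%classic.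

(* sigma restricts to a field automorphism of Q[zeta] (which then fixes Q);
   its values outside Q[zeta] are irrelevant. *)
Definition galois_automorphism (C : numClosedFieldType) (zeta : C)
    (sigma : C -> C) : Prop :=
  [/\ set_bij (rat_adjoin zeta) (rat_adjoin zeta) sigma,
      sigma 1 = 1,
      {in rat_adjoin zeta &, {morph sigma : x y / x + y}}
    & {in rat_adjoin zeta &, {morph sigma : x y / x * y}}].

(* The action (x, y) w = x^s w y^-1; for x = c^i and y = c'^j this is
   c^(s i) w c'^(-j). *)
Definition twisted_act (gT : finGroupType) (s : int) (xy : gT * gT) (w : gT) :
    gT :=
  (expgz xy.1 s * w * xy.2^-1)%g.

(* Main.v *)
(* Write S = C[V], let I be the coinvariant ideal, and let e_t be homogeneous
   polynomials whose classes form a basis of S/I.  Divided differences by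
   reflections (Chevalley) show that the e_t are linearly independent over the
   invariants, which bounds their number by |W|, and by graded Nakayama they
   form a basis of S over the invariants.

   A regular vector v has a free orbit (Steinberg): products of the differences
   g(l) - h(l), l linear, give dual families sum_t h(e_t) y_t = P for h = 1 and
   0 otherwise, where P is a product of linear forms vanishing on the fixed
   spaces.  The factors of P belonging to nonreflections can be replaced by
   coprime ones, hence removed; the remaining P does not vanish at v, so
   evaluating at v rules out a nontrivial h fixing v.

   Evaluation of the e_t on the free orbit Wv is thus an invertible matrix.  It
   intertwines the action of (g, c^a), up to a strictly triangular term, with
   the permutation x -> g^-1 x c^a of W, since c v = omega v.  Taking traces
   gives the graded characters at omega^a (Springer), so that
   f^chi(omega^-a) = chi(c^a).  As sigma raises the eigenvalues of the
   representing matrices of c, which are powers of omega, to the power s, the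
   theorem becomes the second orthogonality relation. *)

Require Import Defs.
From HB Require Import structures.
From mathcomp Require Import ring zify.

Set Implicit Arguments.
Unset Strict Implicit.
Unset Printing Implicit Defensive.

Import GroupScope GRing.Theory Num.Theory.
Local Open Scope ring_scope.

(** * Divisibility by linear forms in the polynomial ring *)

Section LinearForms.
Variables (C : fieldType) (n : nat).
Local Notation S := {mpoly C[n]}.
Implicit Types (f g m : S) (a b : 'rV[C]_n).

Definition linear_form a : S := \sum_(j < n) a 0 j *: 'X_j.

Lemma linear_form_is_linear : linear linear_form.
Proof.
move=> c a b; rewrite /linear_form scaler_sumr -big_split /=.
by apply: eq_bigr => j _; rewrite !mxE scalerDl scalerA.
Qed.

HB.instance Definition _ :=
  GRing.isLinear.Build C 'rV[C]_n S _ linear_form linear_form_is_linear.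

Lemma coef_linear_form a i : (linear_form a)@_U_(i) = a 0 i.
Proof.
rewrite /linear_form raddf_sum /= (bigD1 i) //= mcoeffZ mcoeffXU eqxx mulr1.
by rewrite big1 ?addr0 // => j ji; rewrite mcoeffZ mcoeffXU (negPf ji) mulr0.
Qed.

Lemma linear_form_inj : injective linear_form.
Proof.
by move=> a b ab; apply/rowP => i; rewrite -!coef_linear_form ab.
Qed.

Lemma linear_form_eq0 a : (linear_form a == 0) = (a == 0).
Proof. by rewrite -(linear0 (@linear_form)) (inj_eq linear_form_inj). Qed.

Lemma linear_form_homog a : linear_form a \is 1.-homog.
Proof.
by apply: rpred_sum => j _; apply: rpredZ; rewrite dhomogX /= mdeg1.
Qed.

Lemma meval_linear_form a (v : 'cV[C]_n) :
  (linear_form a).@[fun i => v i 0] = (a *m v) 0 0.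
Proof.
rewrite /linear_form raddf_sum mxE /=; apply: eq_bigr => j _.
by rewrite mevalZ mevalXU.
Qed.

(** Substitution is a ring homomorphism, so congruence modulo [m] may be tested on the variables. *)
Lemma mpoly_congr (k : nat) (t t' : n.-tuple {mpoly C[k]}) (m : {mpoly C[k]}) :
  (forall i, exists q, tnth t i - tnth t' i = m * q) ->
  forall f, exists q, (f \mPo t) - (f \mPo t') = m * q.
Proof.
move=> tt'.
have cong_mul (x x' y y' : {mpoly C[k]}) : (exists q, x - x' = m * q) ->
    (exists q, y - y' = m * q) -> exists q, x * y - x' * y' = m * q.
  move=> [q xx'] [r yy']; exists (q * y + x' * r).
  rewrite mulrDr mulrA -xx' mulrCA -yy'; ring.
elim/mpolyind => [|c mm p _ _ [q IH]]; first by exists 0;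
  rewrite !comp_mpoly0 subrr mulr0.
have [r Hr] : exists r, ('X_[mm] \mPo t) - ('X_[mm] \mPo t') = m * r.
  rewrite !comp_mpolyX; elim/big_ind2: _ => [|x x' y y'|i _].
  - by exists 0; rewrite subrr mulr0.
  - exact: cong_mul.
  elim: (mm i) => [|l IHl]; first by exists 0; rewrite subrr mulr0.
  by rewrite !exprS; apply: cong_mul.
exists (c *: r + q); rewrite !comp_mpolyD !comp_mpolyZ mulrDr -scalerAr -Hr -IH.
by rewrite scalerBr opprD addrACA.
Qed.

(* Modulo a nonzero linear form one variable can be eliminated, so that the
   quotient is again a domain. *)
Lemma linear_form_elim a : a != 0 -> exists t : n.-tuple S,
  [/\ linear_form a \mPo t = 0,
      forall f, f \mPo t = 0 -> exists q, f = linear_form a * q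
    & forall b, linear_form b \mPo t = 0 -> exists c, b = c *: a].
Proof.
case/rV0Pn=> i ai.
(* [t] solves the equation [linear_form a = 0] for ['X_i], where [a 0 i] is nonzero, and keeps the
   other variables. *)
pose t := [tuple 'X_j - ((j == i)%:R / a 0 i) *: linear_form a | j < n].
have tE b : linear_form b \mPo t = linear_form (b - (b 0 i / a 0 i) *: a).
  rewrite {1}/linear_form raddf_sum linearB linearZ /=.
  under eq_bigr => j _ do rewrite comp_mpolyZ comp_mpolyXU -tnth_nth
    tnth_mktuple scalerBr.
  rewrite sumrB; congr (_ - _); rewrite (bigD1 i) //= big1 => [|j ji].
    by rewrite addr0 eqxx scalerA mulrA mulr1.
  by rewrite (negPf ji) mul0r scale0r scaler0.
exists t; split.
- by rewrite tE divff // scale1r subrr linear0.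
- move=> f ft.
  have [|q] := @mpoly_congr n [tuple 'X_j | j < n] t (linear_form a) _ f.
    move=> j; exists ((j == i)%:R / a 0 i)%:MP;
      rewrite !tnth_mktuple opprB addrC subrK.
    by rewrite [RHS]mulrC mul_mpolyC.
  by rewrite comp_mpoly_id ft subr0 => ->; exists q.
- move=> b; rewrite tE -[X in _ = X](linear0 linear_form) => /linear_form_inj
  /eqP.
  by rewrite subr_eq0 => /eqP ->; eexists.
Qed.

(** The substitution from [linear_form_elim] has values in a domain and kills exactly the multiples
    of [linear_form a]; it does not kill [linear_form b], hence it kills [f]. *)
Lemma linear_form_coprime a b f : a != 0 -> (forall c, b <> c *: a) ->
  (exists q, linear_form b * f = linear_form a * q) ->
  exists q, f = linear_form a * q.
Proof.
move=> a0 ab [q E]; have [t [ta tdvd tb]] := linear_form_elim a0.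
apply: tdvd; have /eqP : (linear_form b * f) \mPo t = 0.
  by rewrite E rmorphM /= ta mul0r.
rewrite rmorphM /= mulf_eq0 => /orP[/eqP /tb[c] /ab //|/eqP //].
Qed.

End LinearForms.

Lemma natr_cardG_neq0 (C : numClosedFieldType) (gT : finGroupType)
  (G : {group gT}) : #|G|%:R != 0 :> C.
Proof. by rewrite pnatr_eq0 -lt0n cardG_gt0. Qed.

(** * The action on polynomials, invariants and the coinvariant ideal *)

Section Action.
Variables (C : numClosedFieldType) (gT : finGroupType) (G : {group gT}).
Variables (n : nat) (rG : mx_representation C G n).
Local Notation S := {mpoly C[n]}.
Local Notation act := (poly_act rG).
Local Notation ideal := (coinvariant_ideal rG).
Implicit Types (f p q : S) (g h : gT).

Definition invariant f := forall g, g \in G -> act g f = f.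

Lemma poly_actE g f :
  act g f = f \mPo [tuple linear_form (row i (rG g^-1%g)) | i < n].
Proof.
congr (_ \mPo _); apply: eq_from_tnth => i; rewrite !tnth_mktuple.
by apply: eq_bigr => j _; rewrite mxE.
Qed.

HB.instance Definition _ g := GRing.LRMorphism.copy (act g)
  (comp_mpoly [tuple \sum_(j < n) rG g^-1%g i j *: 'X_j | i < n]).

Lemma poly_act_sum g (I : Type) (r : seq I) (P : pred I) (F : I -> S) :
  act g (\sum_(i <- r | P i) F i) = \sum_(i <- r | P i) act g (F i).
Proof. exact: linear_sum. Qed.

Lemma poly_act_prod g (I : Type) (r : seq I) (P : pred I) (F : I -> S) :
  act g (\prod_(i <- r | P i) F i) = \prod_(i <- r | P i) act g (F i).
Proof. exact: rmorph_prod. Qed.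

Lemma poly_actZ g c f : act g (c *: f) = c *: act g f.
Proof. exact: linearZ. Qed.

Lemma poly_act_mul g f p : act g (f * p) = act g f * act g p.
Proof. exact: rmorphM. Qed.

Lemma poly_actB g f p : act g (f - p) = act g f - act g p.
Proof. exact: rmorphB. Qed.

Lemma poly_act_const g c : act g c%:MP = c%:MP.
Proof. exact: comp_mpolyC. Qed.

Lemma poly_actX g i : act g 'X_i = linear_form (row i (rG g^-1%g)).
Proof. by rewrite poly_actE comp_mpolyXU -tnth_nth tnth_mktuple. Qed.

Lemma poly_act_form g (a : 'rV_n) :
  act g (linear_form a) = linear_form (a *m rG g^-1%g).
Proof.
rewrite {1}/linear_form poly_act_sum mulmx_sum_row linear_sum /=.
by apply: eq_bigr => i _; rewrite poly_actZ poly_actX linearZ.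
Qed.

(** Both sides are algebra morphisms in [f], so the variables suffice; the inverse in [poly_act]
    turns right multiplication of forms into a left action. *)
Lemma poly_actM g h f : g \in G -> h \in G -> act (g * h)%g f = act g (act h f).
Proof.
move=> Gg Gh.
have XE i : act (g * h)%g 'X_i = act g (act h 'X_i).
  by rewrite !poly_actX poly_act_form invMg repr_mxM ?groupV // !rowE mulmxA.
rewrite [f]mpolyE [act (g * h) _]poly_act_sum [act h _]poly_act_sum
  poly_act_sum.
apply: eq_bigr => m _; rewrite !poly_actZ mpolyXE_id.
rewrite [act (g * h) _]poly_act_prod [act h _]poly_act_prod poly_act_prod.
congr (_ *: _).
by apply: eq_bigr => i _; rewrite !rmorphXn /= XE.
Qed.

Lemma poly_act1 f : act 1%g f = f.
Proof.
rewrite poly_actE -[RHS]comp_mpoly_id; congr (_ \mPo _).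
apply: eq_from_tnth => i; rewrite !tnth_mktuple invg1 repr_mx1 row1.
rewrite /linear_form (bigD1 i) //= big1 => [|j ji]; rewrite !mxE.
  by rewrite !eqxx scale1r addr0.
by rewrite (negPf ji) andbF scale0r.
Qed.

Lemma meval_poly_act g f (v : 'cV[C]_n) :
  (act g f).@[fun i => v i 0] = f.@[fun i => (rG g^-1%g *m v) i 0].
Proof.
rewrite poly_actE comp_mpoly_meval; apply: meval_eq => i.
rewrite tnth_mktuple meval_linear_form !mxE.
by apply: eq_bigr => j _; rewrite mxE.
Qed.

Lemma pihomog_poly_act d g f :
  pihomog mdeg d (act g f) = act g (pihomog mdeg d f).
Proof.
have homX m : act g 'X_[m] \is (mdeg m).-homog.
  rewrite poly_actE comp_mpolyX mdegE.
  elim/big_ind2: _ => [|x d1 y d2 hx hy|i _]; first exact: dhomog1.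
    exact: dhomogM.
  rewrite tnth_mktuple.
  by have := dhomogMn (m i) (linear_form_homog (row i (rG g^-1%g)));
    rewrite mul1n.
rewrite [in RHS]pihomogE {1}[f]mpolyE !poly_act_sum linear_sum.
rewrite [RHS]big_mkcond /=; apply: eq_bigr => m _;
  rewrite !poly_actZ linearZ /=.
case: eqP => [<-|/eqP md]; first by rewrite pihomog_dE.
by rewrite (pihomog_ne0 md) // scaler0.
Qed.

Lemma dhomog_poly_act d g f : f \is d.-homog -> act g f \is d.-homog.
Proof.
by move=> hf; rewrite homog_piE pihomog_poly_act (pihomog_dE hf).
Qed.

Lemma invariant0 : invariant 0.
Proof. by move=> g _; rewrite raddf0. Qed.

Lemma invariantC c : invariant c%:MP.
Proof. by move=> g _; rewrite poly_act_const. Qed.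

Lemma invariantD f p : invariant f -> invariant p -> invariant (f + p).
Proof. by move=> hf hp g Gg; rewrite rmorphD /= hf ?hp. Qed.

Lemma invariantM f p : invariant f -> invariant p -> invariant (f * p).
Proof. by move=> hf hp g Gg; rewrite poly_act_mul hf ?hp. Qed.

Lemma invariantN f : invariant f -> invariant (- f).
Proof. by move=> hf g Gg; rewrite rmorphN /= hf. Qed.

Lemma invariant_pihomog d f : invariant f -> invariant (pihomog mdeg d f).
Proof. by move=> hf g Gg; rewrite -pihomog_poly_act hf. Qed.

(** The Reynolds operator up to the factor [#|G|]. *)
Definition orbit_sum f := \sum_(g in G) act g f.

Lemma orbit_sumD f p : orbit_sum (f + p) = orbit_sum f + orbit_sum p.
Proof.
by rewrite /orbit_sum -big_split; apply: eq_bigr => g _; rewrite rmorphD.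
Qed.

Lemma orbit_sum0 : orbit_sum 0 = 0.
Proof. by rewrite /orbit_sum big1 // => g _; rewrite raddf0. Qed.

Lemma orbit_sum_sum (I : Type) (r : seq I) (P : pred I) (F : I -> S) :
  orbit_sum (\sum_(i <- r | P i) F i) = \sum_(i <- r | P i) orbit_sum (F i).
Proof. exact: (big_morph _ orbit_sumD orbit_sum0). Qed.

Lemma orbit_sum_invariant f : invariant (orbit_sum f).
Proof.
move=> h Gh; rewrite /orbit_sum poly_act_sum [RHS](reindex_inj (mulgI h)) /=.
rewrite [RHS](eq_bigl (mem G)) => [|g]; last by rewrite /= groupMl.
by apply: eq_bigr => g Gg; rewrite poly_actM.
Qed.

Lemma orbit_sumM f p : invariant f -> orbit_sum (f * p) = f * orbit_sum p.
Proof.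
move=> hf; rewrite /orbit_sum mulr_sumr; apply: eq_bigr => g Gg.
by rewrite poly_act_mul hf.
Qed.

Lemma coinvariant_ideal0 : ideal 0.
Proof.
exists 0%N, (fun=> 0), (fun=> 0); split=> [[]//|].
by rewrite big_ord0.
Qed.

Lemma coinvariant_idealD f p : ideal f -> ideal p -> ideal (f + p).
Proof.
move=> [k [a [b [hb ->]]]] [k' [a' [b' [hb' ->]]]].
exists (k + k')%N.
exists (fun i => match fintype.split i with inl i => a i | inr i => a' i end).
exists (fun i => match fintype.split i with inl i => b i | inr i => b' i end).
split; first by move=> i; case: fintype.splitP => j _.
rewrite big_split_ord /=; congr (_ + _); apply: eq_bigr => i _.
  by rewrite (fintype.unsplitK (inl i)).
by rewrite (fintype.unsplitK (inr i)).
Qed.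

Lemma coinvariant_idealMl f p : ideal f -> ideal (p * f).
Proof.
move=> [k [a [b [hb ->]]]]; exists k, (fun i => p * a i), b; split=> //.
by rewrite mulr_sumr; apply: eq_bigr => i _; rewrite mulrA.
Qed.

Lemma coinvariant_idealZ f c : ideal f -> ideal (c *: f).
Proof. by rewrite -mul_mpolyC; apply: coinvariant_idealMl. Qed.

Lemma coinvariant_idealN f : ideal f -> ideal (- f).
Proof. by rewrite -scaleN1r; apply: coinvariant_idealZ. Qed.

Lemma coinvariant_idealB f p : ideal f -> ideal p -> ideal (f - p).
Proof. by move=> hf /coinvariant_idealN; apply: coinvariant_idealD. Qed.

Lemma coinvariant_ideal_sum (I : Type) (r : seq I) (P : pred I) (F : I -> S) :
  (forall i, P i -> ideal (F i)) -> ideal (\sum_(i <- r | P i) F i).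
Proof.
move=> hF; elim/big_ind: _ => //; [exact: coinvariant_ideal0|].
exact: coinvariant_idealD.
Qed.

Lemma positive_invariant_ideal f : positive_invariant rG f -> ideal f.
Proof.
move=> hf; exists 1%N, (fun=> 1), (fun=> f); split=> //.
by rewrite big_ord1 mul1r.
Qed.

Lemma invariant_ideal f : invariant f -> ideal (f - (f@_0%MM)%:MP).
Proof.
move=> hf; apply: positive_invariant_ideal; split.
  by apply/invariantD/invariantN/invariantC.
by rewrite mcoeffB mcoeffC eqxx mulr1 subrr.
Qed.

End Action.

(** * Chevalley's argument: independence over the invariants *)

Section Chevalley.
Variables (C : numClosedFieldType) (gT : finGroupType) (G : {group gT}).
Variables (n : nat) (rG : mx_representation C G n).
Local Notation S := {mpoly C[n]}.
Local Notation act := (poly_act rG).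
Local Notation ideal := (coinvariant_ideal rG).
Local Notation invariant := (invariant rG).
Local Notation orbit_sum := (orbit_sum rG).

(** On linear forms, [1 - g] is right multiplication by this matrix, whose rank is the codimension
    of the fixed space of [g]. *)
Definition motion (g : gT) : 'M[C]_n := 1%:M - rG g^-1%g.

Lemma mpolyX_sub_act g i : 'X_i - act g 'X_i = linear_form (row i (motion g)).
Proof.
by rewrite poly_actX -['X_i in LHS](poly_act1 rG) poly_actX -linearB -linearB
  /= invg1 repr_mx1.
Qed.

Lemma rank_motion g : g \in G -> (\rank (motion g) + fixed_dim rG g)%N = n.
Proof.
move=> Gg; rewrite /fixed_dim /eigenspace mxrank_ker.
suff -> : \rank (motion g) = \rank ((rG g)^T - 1%:M).
  by rewrite subnKC ?rank_leq_row.
rewrite -[1%:M]trmx1 -linearB mxrank_tr /=.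
have -> : motion g = rG g^-1%g *m (rG g - 1%:M).
  by rewrite /motion mulmxBr mulmx1 repr_mxV // mulVmx ?repr_mx_unit.
by rewrite -mxrank_tr trmx_mul mxrankMfree ?mxrank_tr // row_free_unit
  unitmx_tr repr_mx_unit ?groupV.
Qed.

Lemma reflectionP g : g \in reflections rG -> g \in G /\ \rank (motion g) = 1%N.
Proof.
rewrite inE => /andP[Gg /eqP gn]; split=> //.
by have := rank_motion Gg; rewrite -[RHS]gn => /eqP;
  rewrite -add1n eqn_add2r => /eqP.
Qed.

(** [motion r] has rank one, hence is a column times a row [a]; so [linear_form a] divides each
    ['X_i - act r 'X_i], and then every difference by [mpoly_congr]. *)
Lemma reflection_divided_difference r : r \in reflections rG ->
  exists2 a : 'rV[C]_n, a != 0 & forall f, exists q, f - act r f = linear_form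
    a * q.
Proof.
case/reflectionP=> Gr rk1; have := mulmx_base (motion r).
move: (col_base _) (row_base _) (row_base_free (motion r));
  rewrite rk1 => u a fa ua.
exists a; first by rewrite -mxrank_eq0 (eqnP fa).
have Xr i : 'X_i - act r 'X_i = linear_form a * (u i 0)%:MP.
  rewrite mpolyX_sub_act -ua row_mul [row i u]mx11_scalar mul_scalar_mx mxE.
  by rewrite linearZ /= mulrC mul_mpolyC.
pose t := [tuple linear_form (row i (rG r^-1%g)) | i < n].
move=> f; have [|q] := @mpoly_congr _ _ _ [tuple 'X_j | j < n] t (linear_form
  a) _ f.
  by move=> i; exists (u i 0)%:MP; rewrite -Xr poly_actX !tnth_mktuple.
by rewrite comp_mpoly_id -poly_actE => ->; exists q.
Qed.

Lemma msize_poly_act g (f : S) : (msize (act g f) <= msize f)%N.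
Proof.
rewrite {1}[f]mpolyE poly_act_sum big_seq.
apply: leq_trans (msize_sum _ _ _) _; apply/bigmax_leqP_seq => m fm _.

rewrite poly_actZ; apply: leq_trans (msizeZ_le _ _) _.
have hX : act g 'X_[m] \is (mdeg m).-homog by rewrite dhomog_poly_act //
  dhomogX.
rewrite msizeE; apply/bigmax_leqP_seq => k km _.
by rewrite (dhomog_mf hX) // msize_mdeg_lt.
Qed.

Lemma coinvariant_ideal_act g f : g \in G -> ideal f -> ideal (act g f).
Proof.
move=> Gg [k [a [b [hb ->]]]]; exists k, (fun i => act g (a i)), b; split=> //.
rewrite poly_act_sum; apply: eq_bigr => i _; rewrite poly_act_mul.
by have [-> ] := hb i.
Qed.

Hypothesis hG : complex_reflection_group rG.

(** The ideal is stable under [G], so the elements fixing the class of [f] form a subgroup; it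
    contains the generating reflections. *)
Lemma ideal_sub_act (f : S) : (forall r, r \in reflections rG -> ideal (f - act
  r f)) ->
  forall g, g \in G -> ideal (f - act g f).
Proof.
move=> hr; have [_ genG] := hG.
pose H := [set g in G | `[< ideal (f - act g f) >]].
have gH : group_set H.
  apply/group_setP; split.
    by rewrite inE group1; apply/asboolP; rewrite poly_act1 subrr;
      apply: coinvariant_ideal0.
  move=> g h; rewrite !inE => /andP[Gg /asboolP Ig] /andP[Gh /asboolP Ih].
  rewrite (groupM Gg Gh); apply/asboolP; rewrite (poly_actM rG f Gg Gh).
  have -> : f - act g (act h f) = f - act g f + act g (f - act h f).
    by rewrite poly_actB addrA subrK.
  by apply: coinvariant_idealD => //; apply: coinvariant_ideal_act.
have /fintype.subsetP sGH : G \subset Group gH.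
  rewrite -{1}genG gen_subG; apply/fintype.subsetP => r rr.
  rewrite inE; have [-> _] := reflectionP rr.
  by apply/asboolP/hr.
by move=> g /sGH; rewrite inE => /andP[_ /asboolP].
Qed.

(* Chevalley's argument: divided differences keep the relation and lower the
   degree of [p0]; in degree 0 the relation is averaged over [G].  Allowing a
   factor [u] that is invertible at the origin makes homogeneity unnecessary. *)
Lemma chevalley_relation k (f0 p0 : S) (f p : 'I_k -> S) :
  invariant f0 -> (forall i, invariant (f i)) ->
  f0 * p0 + \sum_i f i * p i = 0 ->
  (forall (u : S) (r : 'I_k -> S), invariant u -> (forall i, invariant (r i)) ->
     u * f0 = \sum_i r i * f i -> u@_0%MM = 0) ->
  ideal p0.
Proof.
move=> hf0 hf hrel hu; have [N] := ubnP (msize p0).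
elim: N => // N IH in p0 p hrel *; rewrite ltnS => p0N.
have Ir r : r \in reflections rG -> ideal (p0 - act r p0).
  move=> rr; have [Gr _] := reflectionP rr.
  have [a a0 hq] := reflection_divided_difference rr.
  have [q0 q0E] := hq p0; have [q qE] := choice (fun i => hq (p i)).
  have la0 : linear_form a != 0 by rewrite linear_form_eq0.
  rewrite q0E; apply: coinvariant_idealMl.
  have [->|q00] := eqVneq q0 0; first exact: coinvariant_ideal0.
  apply: (IH q0 q).
    have hrel' : f0 * act r p0 + \sum_i f i * act r (p i) = 0.
      apply: etrans (raddf0 (act r)).
      have := congr1 (act r) hrel; rewrite rmorphD /= poly_act_mul hf0 //.
      move=> <-; congr (_ + _); rewrite poly_act_sum.
      by apply: eq_bigr => i _; rewrite poly_act_mul hf.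
    (* Subtracting the relation transformed by [r] and cancelling [linear_form a] gives the same
       relation for the quotients. *)
    apply: (mulfI la0); rewrite mulr0 mulrDr mulrCA -q0E mulr_sumr.
    under eq_bigr => i _ do rewrite mulrCA -qE mulrBr.
    by rewrite mulrBr sumrB addrACA -opprD hrel hrel' subrr.
  have : (msize (linear_form a * q0) <= N)%N.
    rewrite -q0E; apply: leq_trans (msizeD_le _ _) _.
    by rewrite msizeN geq_max p0N (leq_trans (msize_poly_act _ _)).
  (* [msize] is the degree plus one and is at least 2 for [linear_form a], so the bound [N] on the
     product gives a strictly smaller one for [q0]. *)
  rewrite msizeM //.
  have [i ai] := rV0Pn _ a0.
  have := @msize_mdeg_lt _ _ (linear_form a) U_(i)%MM.
  rewrite mcoeff_msupp coef_linear_form mdeg1 => /(_ ai).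
  case: (msize (linear_form a)) => [|[|s]] // _; rewrite !addSn /= => sN.
  by apply: leq_trans sN; rewrite ltnS leq_addl.
have IG := ideal_sub_act Ir.
have avg : f0 * orbit_sum p0 + \sum_i f i * orbit_sum (p i) = 0.
  apply: etrans (orbit_sum0 rG);
    rewrite -[in RHS]hrel orbit_sumD orbit_sumM // orbit_sum_sum.
  by congr (_ + _); apply: eq_bigr => i _; rewrite orbit_sumM.
(* The averaged relation has invariant factors throughout, so the hypothesis on [u] applies to
   [orbit_sum p0] itself. *)
have u0 : (orbit_sum p0)@_0%MM = 0.
  apply: (hu _ (fun i => - orbit_sum (p i))).
  - exact: orbit_sum_invariant.
  - by move=> i; apply/invariantN/orbit_sum_invariant.
  apply/eqP; rewrite mulrC -subr_eq0 -sumrN -[X in _ == X]avg; apply/eqP;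
    congr (_ + _).
  by apply: eq_bigr => i _; rewrite mulNr opprK mulrC.
have I1 : ideal (orbit_sum p0).
  by apply: positive_invariant_ideal; split=> //; apply: orbit_sum_invariant.
(* This sum is [#|G|] times [p0]. *)
have : ideal (\sum_(g in G) (p0 - act g p0) + orbit_sum p0).
  by apply: coinvariant_idealD => //; apply: coinvariant_ideal_sum => g;
    apply: IG.
rewrite sumrB subrK sumr_const => /(coinvariant_idealZ #|G|%:R^-1).
by rewrite -scaler_nat scalerA mulVf ?natr_cardG_neq0 // scale1r.
Qed.

Definition ideal_free (T : finType) (e : T -> S) :=
  forall a : T -> C, ideal (\sum_t a t *: e t) -> forall t, a t = 0.

(** If [f ord0] satisfied Chevalley's hypothesis, [e ord0] would lie in the ideal, against freeness.
    So some [u] with nonzero constant term makes [u * f ord0] a combination of the other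
    coefficients, and one term can be eliminated. *)
Lemma ideal_free_invariant_free_ord k (e f : 'I_k -> S) : ideal_free e ->
  (forall i, invariant (f i)) -> \sum_i f i * e i = 0 -> forall i, f i = 0.
Proof.
elim: k => [|k IH] in e f *; first by move=> _ _ _ [].
move=> he hf; rewrite big_ord_recl => rel.
have [/(chevalley_relation (hf ord0) (fun i => hf (lift ord0 i)) rel) e0I|] :=
  EM (forall (u : S) (r : 'I_k -> S), invariant u -> (forall i, invariant (r
    i)) ->
     u * f ord0 = \sum_i r i * f (lift ord0 i) -> u@_0%MM = 0).
  have := he (fun i => (i == ord0)%:R); rewrite big_ord_recl big1 => [|i _].
    by rewrite addr0 scale1r => /(_ e0I ord0) /eqP; rewrite eqxx oner_eq0.
  by rewrite scale0r.
move=> /existsNP[u /existsNP[r /not_implyP[hu /not_implyP[hr]]]].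
move=> /not_implyP[ur /eqP u0].
(* Multiplying the relation by [u] and substituting for [u * f ord0] yields a relation between the
   [e' i] with the remaining coefficients. *)
pose e' i := u * e (lift ord0 i) + r i * e ord0.
have he' : ideal_free e'.
  move=> a ha i.
  (* Modulo the ideal [u] and [r j] equal their constant terms, so a relation between the [e']
     becomes one between the [e] with coefficients [b]. *)
  pose b0 := \sum_j a j * (r j)@_0%MM.
  pose b j := if unlift ord0 j is Some j then u@_0%MM * a j else b0.
  have : b (lift ord0 i) = 0.
    apply: he; rewrite big_ord_recl /b unlift_none.
    under eq_bigr => j _ do rewrite liftK.
    rewrite scaler_suml -big_split /=.
    have -> : \sum_j ((a j * (r j)@_0%MM) *: e ord0 + (u@_0%MM * a j) *: e
      (lift ord0 j)) =
        \sum_j a j *: e' j -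
        \sum_j a j *: (e (lift ord0 j) * (u - (u@_0%MM)%:MP) + e ord0 * (r j -
          ((r j)@_0%MM)%:MP)).
      rewrite -sumrB; apply: eq_bigr => j _;
        rewrite -scalerBr -scalerA [u@_0 * _]mulrC -scalerA -scalerDr.
      congr (_ *: _); rewrite -!mul_mpolyC /e'; ring.
    apply: coinvariant_idealB => //; apply: coinvariant_ideal_sum => j _.
    apply/coinvariant_idealZ/coinvariant_idealD; apply: coinvariant_idealMl;
      exact: invariant_ideal.
  by rewrite /b liftK => /eqP; rewrite mulf_eq0 (negPf u0) => /eqP.
have f1 := IH e' (fun i => f (lift ord0 i)) he' (fun i => hf (lift ord0 i)) _.
have {}f1 i : f (lift ord0 i) = 0.
  apply: f1; apply: etrans (mulr0 u).
  rewrite -[in RHS]rel mulrDr mulrA ur mulr_suml mulr_sumr -big_split /=.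
  by apply: eq_bigr => j _; rewrite /e'; ring.
move=> i; case: (unliftP ord0 i) => [j ->|->] //.
have : u * f ord0 = 0 by rewrite ur big1 // => j _; rewrite f1 mulr0.
move/eqP; rewrite mulf_eq0 => /orP[/eqP uz|/eqP //].
by move: u0; rewrite uz mcoeff0 eqxx.
Qed.

Lemma ideal_free_invariant_free (T : finType) (e f : T -> S) : ideal_free e ->
  (forall t, invariant (f t)) -> \sum_t f t * e t = 0 -> forall t, f t = 0.
Proof.
move=> he hf rel t; rewrite -[t]enum_rankK.
apply: (@ideal_free_invariant_free_ord _ (e \o enum_val) (f \o enum_val)) => [a
  ha i|i|] /=.
- have := he (a \o enum_rank);
  rewrite (reindex_onto enum_val enum_rank) => [|s _]; last exact: enum_rankK.
  under eq_bigl => j do rewrite enum_valK eqxx.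
  under eq_bigr => j _ do rewrite /= enum_valK.
  by move=> /(_ ha (enum_val i)); rewrite /= enum_valK.
- exact: hf.
- rewrite -[RHS]rel [RHS](reindex_onto enum_val enum_rank) => [|s _];
  last exact: enum_rankK.
  by apply: eq_bigl => j; rewrite enum_valK eqxx.
Qed.

End Chevalley.

(** * The matrix of conjugates and the bound by the group order *)

Section Separation.
Variables (C : numClosedFieldType) (gT : finGroupType) (G : {group gT}).
Variables (n : nat) (rG : mx_representation C G n).
Local Notation S := {mpoly C[n]}.
Local Notation act := (poly_act rG).
Local Notation ideal := (coinvariant_ideal rG).
Local Notation invariant := (invariant rG).
Local Notation orbit_sum := (orbit_sum rG).

(** The factor for [g = h] vanishes, so on [G] only the value at the identity can be nonzero. The
    forms [u g] are chosen separately for each [g], which allows factors to be exchanged later. *)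
Definition separator (u : gT -> 'rV[C]_n) (h : gT) : S :=
  \prod_(g in G^#) (act h (linear_form (u g)) - act g (linear_form (u g))).

Lemma separator_eq0 u h : h \in G^# -> separator u h = 0.
Proof. by move=> hG; rewrite /separator (bigD1 h) //= subrr mul0r. Qed.

Lemma separator1 u :
  separator u 1%g = \prod_(g in G^#) linear_form (u g *m motion rG g).
Proof.
apply: eq_bigr => g _; rewrite poly_act1 poly_act_form /motion mulmxBr mulmx1.
by rewrite linearB.
Qed.

(** Reduces a statement on separators to stability under multiplication by a single function
    [act h b - a] of [h]. *)
Lemma separator_ind (K : (gT -> S) -> Prop) u : K (fun=> 1) ->
  (forall phi a b, K phi -> K (fun h => (act h b - a) * phi h)) ->
  K (separator u).
Proof.
move=> K1 KM; rewrite /separator.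
suff Ks s : K (fun h => \prod_(g <- s) (act h (linear_form (u g)) - act g
  (linear_form (u g)))).
  by have := Ks (enum G^#); congr K; apply: funext => h; rewrite big_enum.
elim: s => [|g s IH].
  by move: K1; congr K; apply: funext => h; rewrite big_nil.
have := KM _ (act g (linear_form (u g))) (linear_form (u g)) IH.
by congr K; apply: funext => h; rewrite big_cons.
Qed.

Hypothesis hG : complex_reflection_group rG.

Lemma motion_neq0 g : g \in G^# -> motion rG g != 0.
Proof.
case/setD1P=> g1 Gg; apply: contra_neq g1 => /eqP; rewrite subr_eq0 => /eqP g1.
have [/fintype.subsetP faith _] := hG.
have : g^-1%g \in rker rG by rewrite inE groupV Gg -g1 mul1mx eqxx.
by move/faith; rewrite inE -[_ == _](inj_eq invg_inj) invgK invg1 => /eqP.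
Qed.

Lemma separator_exists : exists u, separator u 1%g != 0.
Proof.
have /choice[u hu] : forall g, exists u : 'rV_n, g \in G^# -> u *m motion rG g
  != 0.
  move=> g; have [Gg|] := boolP (g \in G^#); last by exists 0.
  have /rowV0Pn[_ /submxP[u ->] u0] := motion_neq0 Gg; by exists u.
exists u; rewrite separator1; apply/prodf_neq0 => g Gg.
by rewrite linear_form_eq0 hu.
Qed.

(** Nondegeneracy of the trace form over the invariants: a separator isolates the term of the
    identity in the vanishing orbit sums. *)
Lemma orbit_sum_nondegenerate z : (forall b, orbit_sum (b * z) = 0) -> z = 0.
Proof.
move=> hz; have [i sep] := separator_exists.
have K : forall b, \sum_(h in G) separator i h * act h (b * z) = 0.
  apply: (@separator_ind (fun phi => forall b, \sum_(h in G) phi h * act h (b *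
    z) = 0)).
    by move=> b; under eq_bigr => h _ do rewrite mul1r; exact: hz.
  move=> phi a b' IH b.
  (* The new relation is the old one for [b' * b] minus [a] times the old one for [b]. *)
  have E h : (act h b' - a) * phi h * act h (b * z) =
      phi h * act h (b' * b * z) - a * (phi h * act h (b * z)).
    by rewrite -[b' * b * z]mulrA [act h (b' * _)]poly_act_mul; ring.
  by under eq_bigr => h _ do rewrite E;
    rewrite sumrB -mulr_sumr !IH mulr0 subr0.
have := K 1; rewrite (bigD1 1%g) //= big1 => [|h /andP[Gh h1]].
  rewrite addr0 mul1r poly_act1 => /eqP;
    rewrite mulf_eq0 (negPf sep) => /eqP //.
by rewrite separator_eq0 ?mul0r // !inE h1.
Qed.

(** Applying inverse group elements moves the action from [e] to [z]. For every [b] the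
    [orbit_sum (b * z t)] are then invariant coefficients of a relation between the [e t], hence
    zero, and the trace form is nondegenerate. *)
Lemma conjugates_regular (T : finType) (e z : T -> S) : ideal_free rG e ->
  (forall h, h \in G -> \sum_t act h (e t) * z t = 0) -> forall t, z t = 0.
Proof.
move=> he hz t; apply: orbit_sum_nondegenerate => b; move: t.
apply: (ideal_free_invariant_free hG he) => [t|].
  exact: orbit_sum_invariant.
have hz' h : h \in G -> \sum_t act h (z t) * e t = 0.
  move=> Gh; apply: etrans (raddf0 (act h) : act h 0 = 0).
  have GVh : h^-1%g \in G by rewrite groupV.
  rewrite -[in RHS](hz _ GVh) poly_act_sum; apply: eq_bigr => t _.
  by rewrite poly_act_mul -(poly_actM rG (e t) Gh GVh) mulgV poly_act1 mulrC.
have -> : \sum_t orbit_sum (b * z t) * e t =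
    \sum_(h in G) act h b * \sum_t act h (z t) * e t.
  rewrite /orbit_sum; under eq_bigr => t _ do rewrite mulr_suml.
  rewrite exchange_big; apply: eq_bigr => h _; rewrite mulr_sumr.
  by apply: eq_bigr => t _; rewrite poly_act_mul mulrA.
by rewrite big1 // => h Gh; rewrite hz' // mulr0.
Qed.

Lemma ideal_free_card (T : finType) (e : T -> S) :
  ideal_free rG e -> (#|T| <= #|G|)%N.
Proof.
move=> he; rewrite leqNgt; apply/negP => GT.
(* The rectangular matrix of conjugates is padded to a square one by zero columns; the assumption
   provides at least one, so the determinant vanishes. *)
pose A := \matrix_(i < #|T|, j < #|T|)
  if (j < #|G|)%N then act (nth 1%g (enum G) j) (e (enum_val i)) else 0 : S.
have /det0P[v v0 vA] : \det A == 0.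
  rewrite -det_tr; apply/det0P; exists (delta_mx 0 (Ordinal GT)).
    by apply/eqP => /matrixP/(_ 0 (Ordinal GT)); rewrite !mxE !eqxx => /eqP;
      rewrite oner_eq0.
  by rewrite -rowE; apply/rowP => i; rewrite !mxE ltnn.
have vE : forall t, v 0 (enum_rank t) = 0.
  apply: (conjugates_regular he) => h Gh.
  have hG' : (index h (enum G) < #|G|)%N by rewrite cardE index_mem mem_enum.
  have /rowP/(_ (Ordinal (ltn_trans hG' GT))) := vA; rewrite !mxE;
    apply: etrans.
  rewrite [RHS](reindex_onto enum_rank enum_val) => [|j _];
    last exact: enum_valK.
  apply: eq_big => [t|t _]; first by rewrite enum_rankK eqxx.
  by rewrite !mxE /= hG' enum_rankK nth_index ?mem_enum // mulrC.
by case/rV0Pn: v0 => j; rewrite -[j]enum_valK vE eqxx.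
Qed.

End Separation.

(** * Homogeneous components of products *)

Section HomogeneousParts.
Variables (C : fieldType) (n : nat).
Implicit Types (f p q : {mpoly C[n]}).

(** Both sides are bilinear in [p] and [q], which reduces the formula to monomials. *)
Lemma pihomogM d p q : pihomog mdeg d (p * q) =
  \sum_(l < d.+1) pihomog mdeg (d - l) p * pihomog mdeg l q.
Proof.
elim/mpolyind: p => [|c m p _ _ IH].
  by rewrite mul0r pihomog0 big1 // => l _; rewrite pihomog0 mul0r.
rewrite mulrDl pihomogD IH; under [RHS]eq_bigr do rewrite pihomogD mulrDl.
rewrite big_split /=; congr (_ + _).
rewrite -scalerAl linearZ /=; under eq_bigr do rewrite linearZ /= -scalerAl.
rewrite -scaler_sumr; congr (_ *: _) => {c p IH}.
elim/mpolyind: q => [|c k q _ _ IH].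
  by rewrite mulr0 pihomog0 big1 // => l _; rewrite pihomog0 mulr0.
rewrite mulrDr pihomogD IH; under [RHS]eq_bigr do rewrite pihomogD mulrDr.
rewrite big_split /=; congr (_ + _).
rewrite -scalerAr linearZ /=; under eq_bigr do rewrite linearZ /= -scalerAr.
rewrite -scaler_sumr; congr (_ *: _) => {c q IH}.
rewrite -mpolyXD pihomogX /= mdegD.
under eq_bigr => l _ do rewrite !pihomogX /=.
have [kd|dk] := leqP (mdeg k) d.
  rewrite (bigD1 (Ordinal (kd : mdeg k < d.+1)%N)) //= eqxx big1 => [|l lk].
    have -> : (mdeg m == d - mdeg k)%N = (mdeg m + mdeg k == d)%N by lia.
    by rewrite addr0; case: ifP => _; rewrite ?mul0r // mpolyXD.
  have /negPf -> : mdeg k != l by apply: contra lk => /eqP kl;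
    apply/eqP/val_inj.
  by rewrite mulr0.
rewrite big1 => [|l _]; first by rewrite ifN //; lia.
by rewrite [in X in _ * X]ifN ?mulr0 //; have := ltn_ord l; lia.
Qed.

Lemma pihomog0E p : pihomog mdeg 0 p = (p@_0%MM)%:MP.
Proof.
elim/mpolyind: p => [|c m p _ _ IH]; first by rewrite pihomog0 mcoeff0 mpolyC0.
rewrite pihomogD linearZ /= IH mcoeffD mpolyCD mcoeffZ mcoeffX; congr (_ + _).
rewrite pihomogX /= mdeg_eq0; case: eqP => [->|_];
  last by rewrite scaler0 mulr0 mpolyC0.
by rewrite mpolyX0 mulr1 -mul_mpolyC mulr1.
Qed.

End HomogeneousParts.

(** * Homogeneous bases of the coinvariant algebra *)

Section CoinvariantBasis.
Variables (C : numClosedFieldType) (gT : finGroupType) (G : {group gT}).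
Variables (n : nat) (rG : mx_representation C G n).
Local Notation S := {mpoly C[n]}.
Local Notation act := (poly_act rG).
Local Notation ideal := (coinvariant_ideal rG).
Local Notation invariant := (invariant rG).

(** The generators may be replaced by their homogeneous components: these are invariant, and the one
    of degree 0 vanishes. *)
Lemma ideal_pihomog d f : ideal f -> ideal (pihomog mdeg d f).
Proof.
move=> [k [a [b [hb ->]]]]; rewrite linear_sum.
apply: coinvariant_ideal_sum => i _; rewrite /= pihomogM.
apply: coinvariant_ideal_sum => l _; apply: coinvariant_idealMl.
have [bi b0] := hb i; case: (nat_of_ord l) => [|{}l].
  by rewrite pihomog0E b0 mpolyC0; apply: coinvariant_ideal0.
apply: positive_invariant_ideal; split; first exact: invariant_pihomog.
apply: (@dhomog_nemf_coeff _ _ mdeg l.+1); first exact: pihomogP.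
by rewrite /= mdeg0.
Qed.

Hypothesis hG : complex_reflection_group rG.

(** The bound by [#|G|] allows a free family of maximal size, and maximality makes it spanning. *)
Lemma coinvariant_basis_exists d :
  exists k (e : 'I_k -> S), coinvariant_basis rG d e.
Proof.
pose P k := `[< exists e : 'I_k -> S, (forall i, e i \is d.-homog) /\
  ideal_free rG e >].
have exP : exists k, P k.
  by exists 0%N; apply/asboolP; exists (fun=> 0); split=> [[]|a _ []].
have leP k : P k -> (k <= #|G|)%N.
  by move=> /asboolP[e [_ /(ideal_free_card hG)]]; rewrite card_ord.
case: (ex_maxnP exP leP) => k /asboolP[e [he efree]] kmax.
exists k, e; split=> // f hf; apply: contrapT => nf.
suff /asboolP/kmax : exists e : 'I_k.+1 -> S, (forall i, e i \is d.-homog) /\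
  ideal_free rG e.
  by rewrite ltnn.
exists (fun i => if unlift ord0 i is Some j then e j else f); split.
  by move=> i; case: unliftP.
move=> a; rewrite big_ord_recl unlift_none;
  under eq_bigr => i _ do rewrite liftK.
move=> Ia; have a0 : a ord0 = 0.
  apply: contra_notP nf => /eqP a0.
  exists (fun i => - (a ord0)^-1 * a (lift ord0 i)).
  have := coinvariant_idealZ (a ord0)^-1 Ia.
  rewrite scalerDr scalerA mulVf // scale1r scaler_sumr; congr (ideal (_ + _)).
  by rewrite -sumrN; apply: eq_bigr => i _; rewrite scalerA mulNr scaleNr opprK.
move=> i; case: (unliftP ord0 i) => [j ->|-> //].
by apply: (efree (a \o lift ord0)); move: Ia; rewrite a0 scale0r add0r.
Qed.

Definition graded_basis (T : finType) (deg : T -> nat) (e : T -> S) :=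
  [/\ forall t, e t \is (deg t).-homog, ideal_free rG e
    & forall d f, f \is d.-homog -> exists a : T -> C,
        (forall t, deg t != d -> a t = 0) /\ ideal (f - \sum_t a t *: e t)].

Section FullBasis.
Variables (K : nat -> nat) (e : forall d, 'I_(K d) -> S).
Hypothesis he : forall d, coinvariant_basis rG d (@e d).

Definition basis_index D := {d : 'I_D & 'I_(K d)}.
Definition pack D (d : 'I_D) (i : 'I_(K d)) : basis_index D :=
  @Tagged _ d (fun d : 'I_D => 'I_(K d)) i.
Definition full_basis D (t : basis_index D) : S := e (tagged t).

Lemma full_basis_homog D (t : basis_index D) : full_basis t \is (tag t).-homog.
Proof. by have [h _ _] := he (tag t); apply: h. Qed.

Lemma sum_basis_index D (V : nmodType) (F : basis_index D -> V) :
  \sum_t F t = \sum_(d < D) \sum_(i < K d) F (pack i).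
Proof. by rewrite sig_big_dep; apply: eq_bigr => [[d i]]. Qed.

(** Homogeneity of the ideal separates a relation into its degrees. *)
Lemma full_basis_free D : ideal_free rG (@full_basis D).
Proof.
move=> a Ia; case=> d i; have [eh ef _] := he d.
apply: (ef (fun i => a (pack i))); have := ideal_pihomog d Ia.
rewrite sum_basis_index.
rewrite linear_sum (bigD1 d) //= [X in _ + X]big1 ?addr0 => [|d' d'd].
  by rewrite linear_sum /=;
    under eq_bigr => j _ do rewrite linearZ /= (pihomog_dE (eh j)).
rewrite linear_sum big1 // => j _; rewrite /= linearZ /=.
have [eh' _ _] := he d'.
by rewrite (pihomog_ne0 _ (eh' j)) ?scaler0.
Qed.

Lemma full_basis_graded D :
  (forall d f, (D <= d)%N -> f \is d.-homog -> ideal f) ->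
  graded_basis (fun t : basis_index D => tag t : nat) (@full_basis D).
Proof.
move=> topD; split; [exact: full_basis_homog|exact: full_basis_free|].
move=> d f hf; have [dD|Dd] := ltnP d D; last first.
  exists (fun=> 0); split=> //; rewrite big1 ?subr0 => [|t _];
    first exact: topD hf.
  by rewrite scale0r.
have [_ _ /(_ f hf)[a Ia]] := he d.
(* [insub] identifies the indices of equal degrees without a type cast. *)
pose b (t : basis_index D) :=
  if insub (tagged t : nat) is Some i then (tag t == d :> nat)%:R * a i else 0.
exists b; split=> [t /negPf td|]; first by rewrite /b;
  case: insubP => // i _ _; rewrite td mul0r.
rewrite sum_basis_index (bigD1 (Ordinal dD)) //= [X in _ - (_ + X)]big1 ?addr0
  => [|d' d'd].
  move: Ia; congr (ideal (_ - _)); apply: eq_bigr => i _.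
  by rewrite /b /= valK eqxx mul1r.
apply: big1 => i _; rewrite /b /=; case: insubP => [j _ _|];
  last by rewrite scale0r.
by move/negPf: d'd; rewrite -val_eqE /= => ->; rewrite mul0r scale0r.
Qed.

Lemma sum_dim_le D : (\sum_(d < D) K d <= #|G|)%N.
Proof.
have := ideal_free_card hG (@full_basis_free D).
by rewrite card_tagged sumnE big_map big_enum;
  under eq_bigr do rewrite card_ord.
Qed.

End FullBasis.

(** The partial sums of the dimensions are bounded by [#|G|]; once the largest one is attained, all
    later dimensions are zero. *)
Lemma coinvariant_top_degree : exists D, forall d f,
  (D <= d)%N -> f \is d.-homog -> ideal f.
Proof.
have [K hK] := choice coinvariant_basis_exists.
have he d := projT2 (cid (hK d)).
pose P m := `[< exists D, \sum_(d < D) K d = m >]%N.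
have exP : exists m, P m by exists (\sum_(d < 0) K d)%N; apply/asboolP;
  exists 0%N.
have leP m : P m -> (m <= #|G|)%N.
  by move=> /asboolP[D <-]; apply: (sum_dim_le he).
case: (ex_maxnP exP leP) => m /asboolP[D Dm] mmax; exists D => d f Dd hf.
have Kd : K d = 0%N.
  have /asboolP/mmax : exists D, (\sum_(d < D) K d = \sum_(d' < d.+1) K d')%N
    by exists d.+1.
  rewrite big_ord_recr /= -Dm -!(big_mkord xpredT K) (big_cat_nat _ Dd) //=.
  lia.
have [_ _ /(_ f hf)[a]] := he d.
by rewrite big1 ?subr0 // => i; have : (i < 0)%N by rewrite -[X in (_ < X)%N]Kd.
Qed.

Lemma graded_basis_exists : exists (T : finType) (deg : T -> nat) (e : T -> S),
  graded_basis deg e.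
Proof.
have [D topD] := coinvariant_top_degree.
have [K hK] := choice coinvariant_basis_exists.
have he d := projT2 (cid (hK d)).
exists (basis_index K D), (fun t : basis_index K D => tag t : nat),
  (@full_basis _ (fun d => projT1 (cid (hK d))) D).
exact: (full_basis_graded he topD).
Qed.

End CoinvariantBasis.

(** * Graded Nakayama, dual families and Steinberg's theorem *)

Section Freeness.
Variables (C : numClosedFieldType) (gT : finGroupType) (G : {group gT}).
Variables (n : nat) (rG : mx_representation C G n).
Local Notation S := {mpoly C[n]}.
Local Notation act := (poly_act rG).
Local Notation ideal := (coinvariant_ideal rG).
Local Notation invariant := (invariant rG).

Hypothesis hG : complex_reflection_group rG.

Variables (T : finType) (deg : T -> nat) (e : T -> S).
Hypothesis he : graded_basis rG deg e.

(** The bound [b] is strict; keeping track of it makes the error terms in Springer's argument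
    strictly triangular. *)
Definition spanned b (f : S) := exists r : T -> S,
  [/\ forall t, invariant (r t), forall t, (b <= deg t)%N -> r t = 0
    & f = \sum_t r t * e t].

Lemma spanned0 b : spanned b 0.
Proof.
exists (fun=> 0); split=> // [t|]; first exact: invariant0.
by rewrite big1 // => t _; rewrite mul0r.
Qed.

Lemma spannedD b f p : spanned b f -> spanned b p -> spanned b (f + p).
Proof.
move=> [r [hr r0 ->]] [s [hs s0 ->]]; exists (fun t => r t + s t); split.
- by move=> t; apply: invariantD.
- by move=> t bt; rewrite r0 // s0 // addr0.
- by rewrite -big_split; apply: eq_bigr => t _; rewrite mulrDl.
Qed.

Lemma spanned_sum (I : Type) (s : seq I) (P : pred I) (F : I -> S) b :
  (forall i, P i -> spanned b (F i)) -> spanned b (\sum_(i <- s | P i) F i).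
Proof.
by move=> hF; elim/big_ind: _ => //; [exact: spanned0|exact: spannedD].
Qed.

Lemma spannedMl b p f : invariant p -> spanned b f -> spanned b (p * f).
Proof.
move=> hp [r [hr r0 ->]]; exists (fun t => p * r t); split.
- by move=> t; apply: invariantM.
- by move=> t bt; rewrite r0 // mulr0.
- by rewrite mulr_sumr; apply: eq_bigr => t _; rewrite mulrA.
Qed.

Lemma spannedW b b' f : (b <= b')%N -> spanned b f -> spanned b' f.
Proof.
move=> bb' [r [hr r0 ->]]; exists r; split=> // t bt.
by rewrite r0 // (leq_trans bb').
Qed.

Lemma spanned_basis t : spanned (deg t).+1 (e t).
Proof.
exists (fun s => (s == t)%:R%:MP); split=> [s|s|].
- exact: invariantC.
- by case: eqP => [->|//]; rewrite ltnn.
- rewrite (bigD1 t) //= eqxx mpolyC1 mul1r big1 ?addr0 // => s /negPf ->.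
  by rewrite mpolyC0 mul0r.
Qed.

(** The generators contribute only in positive degree, so their cofactors have degree below [d] and
    are already spanned. *)
Lemma ideal_spanned_of_lower d f :
  (forall l q, (l < d)%N -> q \is l.-homog -> spanned l.+1 q) ->
  f \is d.-homog -> ideal f -> spanned d f.
Proof.
move=> IH hf [k [a [b [hb fE]]]]; rewrite -(pihomog_dE hf) fE linear_sum /=.
apply: spanned_sum => i _; rewrite pihomogM; apply: spanned_sum => -[l ld] _ /=.
have [bi b0] := hb i; case: l ld => [|l] ld.
  by rewrite pihomog0E b0 mpolyC0 mulr0; apply: spanned0.
rewrite mulrC; apply: spannedMl; first exact: invariant_pihomog.
apply: (@spannedW (d - l.+1).+1); first by lia.
by apply: IH; [lia|exact: pihomogP].
Qed.

Lemma homog_spanned d f : f \is d.-homog -> spanned d.+1 f.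
Proof.
have [hom _ dec] := he.
elim/ltn_ind: d => d IH in f *; move=> hf; have [a [a0 Ia]] := dec d f hf.
rewrite -(subrK (\sum_t a t *: e t) f); apply: spannedD.
  apply/(spannedW (leqnSn d))/ideal_spanned_of_lower => //.
    by move=> l q /IH; apply.
  apply: rpredB => //; apply: rpred_sum => t _.
  have [<-|/a0 ->] := eqVneq (deg t) d; first exact/rpredZ/hom.
  by rewrite scale0r rpred0.
apply: spanned_sum => t _; have [<-|/a0 ->] := eqVneq (deg t) d.
  by rewrite -mul_mpolyC; apply: spannedMl (spanned_basis t); apply: invariantC.
by rewrite scale0r; apply: spanned0.
Qed.

Lemma ideal_spanned d f : f \is d.-homog -> ideal f -> spanned d f.
Proof. by apply: ideal_spanned_of_lower => l q _; apply: homog_spanned. Qed.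

Lemma invariant_combination f : exists r : T -> S,
  (forall t, invariant (r t)) /\ f = \sum_t r t * e t.
Proof.
suff [r [hr _ ->]] : spanned (msize f) f by exists r.
rewrite [X in spanned _ X](pihomog_partitionE (leqnn (msize f))).
apply: spanned_sum => d _; apply: (spannedW (ltn_ord d)).
by apply: homog_spanned; apply: pihomogP.
Qed.

(** The functions on [G] in the column space of the matrix of conjugates. *)
Definition liftable (phi : gT -> S) := exists y : T -> S,
  forall h, h \in G -> \sum_t act h (e t) * y t = phi h.

(** The constant 1 is liftable, and multiplication by [act h b] preserves liftability: the
    coordinates [R] of [b * e s] are invariant, so the same matrix works for all [h]. *)
Lemma liftable_separator u : liftable (separator rG u).
Proof.
apply: separator_ind => [|phi a b [y hy]].
  have [r [hr r1]] := invariant_combination 1; exists r => h Gh.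
  rewrite -[RHS](rmorph1 (act h)) r1 /= poly_act_sum.
  by apply: eq_bigr => t _; rewrite poly_act_mul hr // mulrC.
have [R hR] := choice (fun s => invariant_combination (b * e s)).
exists (fun t => \sum_s R s t * y s - a * y t) => h Gh.
under eq_bigr => t _ do rewrite mulrBr mulr_sumr [act h (e t) * (a * _)]mulrCA.
rewrite sumrB -mulr_sumr hy // mulrBl; congr (_ - _).
rewrite exchange_big /= -hy // mulr_sumr; apply: eq_bigr => s _.
have [inv bs] := hR s; rewrite mulrA -poly_act_mul bs poly_act_sum mulr_suml.
by apply: eq_bigr => t _; rewrite poly_act_mul (inv t) // mulrCA mulrA.
Qed.

(** Common denominators of the family dual to the [e t]. *)
Definition conductor (P : S) := liftable (fun h => (h == 1%g)%:R * P).

(** Liftings are unique by [conjugates_regular], which gives the proportion [E]; coprimality then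
    makes [ya] divisible by [linear_form a], and the quotient lifts the indicator of the identity
    times [P]. *)
Lemma conductor_descent (a b : 'rV[C]_n) P : a != 0 -> (forall c, b <> c *: a)
  ->
  conductor (linear_form a * P) -> conductor (linear_form b * P) -> conductor P.
Proof.
move=> a0 ab [ya hya] [yb hyb]; have [_ efree _] := he.
have E t : linear_form b * ya t = linear_form a * yb t.
  apply/eqP; rewrite -subr_eq0; apply/eqP; move: t.
  apply: (conjugates_regular hG efree) => h Gh.
  under eq_bigr => t _ do rewrite mulrBr mulrCA [act h _ * (linear_form a *
    _)]mulrCA.
  by rewrite sumrB -!mulr_sumr hya // hyb //; ring.
have /choice[y hy] : forall t, exists q, ya t = linear_form a * q.
  by move=> t; apply: (linear_form_coprime a0 ab); exists (yb t).
exists y => h Gh; have la0 : linear_form a != 0 by rewrite linear_form_eq0.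
apply: (mulfI la0); rewrite mulrCA -hya // mulr_sumr.
by apply: eq_bigr => t _; rewrite hy mulrCA.
Qed.

(** For these [g] the rank of [motion g] is at least 2, so its row space is not a line. *)
Lemma nonreflection_forms g : g \in G^# :\: reflections rG ->
  exists a b : 'rV_n, a *m motion rG g != 0 /\
    forall c, b *m motion rG g <> c *: (a *m motion rG g).
Proof.
case/setDP=> Gg ng; have M0 := motion_neq0 hG Gg.
have /rowV0Pn[_ /submxP[a ->] a0] := M0; exists a.
apply: contrapT => nb; case/negP: ng; have [_ Gg'] := setD1P Gg.
rewrite inE Gg' -[X in _ == X](rank_motion rG Gg') -add1n eqn_add2r eq_sym.
rewrite eqn_leq lt0n mxrank_eq0 M0 andbT.
apply: leq_trans (rank_leq_row (a *m motion rG g)); apply/mxrankS/row_subP => i.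
apply: contrapT => nri; apply: nb; exists (delta_mx 0 i); split=> // c rowE'.
by apply: nri; rewrite rowE rowE' scalemx_sub.
Qed.

(** Since the hypothesis allows all [u], the factor of one [g] can be either of two nonproportional
    forms with the others unchanged; descent removes it. *)
Lemma conductor_drop (s : seq gT) Q : uniq s ->
  {subset s <= G^# :\: reflections rG} ->
  (forall u : gT -> 'rV_n,
     conductor (Q * \prod_(g <- s) linear_form (u g *m motion rG g))) ->
  conductor Q.
Proof.
elim: s => [_ _ /(_ (fun=> 0))|g s IH /= /andP[gs us] sN hQ].
  by rewrite big_nil mulr1.
apply: (IH us) => [x xs|u]; first by apply: sN; rewrite inE xs orbT.
have [a [b [a0 ab]]] := nonreflection_forms (sN g (mem_head g s)).
have hc c : conductor (linear_form (c *m motion rG g) *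
    (Q * \prod_(x <- s) linear_form (u x *m motion rG x))).
  have := hQ (fun x => if x == g then c else u x).
  rewrite big_cons eqxx mulrCA; congr (conductor (_ * (_ * _))).
  rewrite [LHS]big_seq [RHS]big_seq; apply: eq_bigr => x xs.
  by rewrite ifN //; apply: contraNneq gs => <-.
exact: conductor_descent a0 ab (hc a) (hc b).
Qed.

(* Steinberg's theorem for regular vectors: evaluating the dual bases at [v]
   would otherwise give both [0] and a product of values of reflecting forms. *)
Lemma regular_vector_free (v : 'cV[C]_n) h : regular_vector rG v ->
  h \in G -> rG h *m v = v -> h = 1%g.
Proof.
move=> vreg Gh hv.
(* For a reflection [g], regularity of [v] gives a linear form vanishing on the hyperplane of [g]
   but not at [v]. *)
have /choice[w hw] : forall g, exists w : 'rV_n,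
    g \in reflections rG -> w *m motion rG g *m v != 0.
  move=> g; have [rg|] := boolP (g \in reflections rG); last by exists 0.
  have [Gg _] := reflectionP rg.
  suff /matrix0Pn[i [j ij]] : motion rG g *m v != 0.
    by exists (delta_mx 0 i) => _; rewrite -rowE -row_mul; apply/rV0Pn;
      exists j; rewrite mxE.
  rewrite mulmxBl mul1mx subr_eq0; apply: contra (vreg g rg) => /eqP vE.
  by rewrite {1}vE mulmxA -repr_mxM ?groupV // mulgV repr_mx1 mul1mx.
pose Q := \prod_(g in reflections rG) linear_form (w g *m motion rG g).
have sR : reflections rG \subset G^#.
  apply/fintype.subsetP => g rg; have [Gg rk] := reflectionP rg.
  rewrite !inE Gg andbT; apply: contra_eqN rk => /eqP ->.
  by rewrite /motion invg1 repr_mx1 subrr mxrank0.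
have [y hy] : conductor Q.
  apply: (@conductor_drop (enum (G^# :\: reflections rG))) => [|x|u].
  - exact: enum_uniq.
  - by rewrite mem_enum.
  have [y hy] := liftable_separator (fun g => if g \in reflections rG then w g
    else u g).
  exists y => k Gk; rewrite hy //; have [->|k1] := eqVneq k 1%g; last first.
    by rewrite mul0r separator_eq0 // !inE k1.
  rewrite mul1r separator1 (big_setID (reflections rG)) /= big_enum
    (finset.setIidPr sR).
  congr (_ * _); apply: eq_bigr => g; first by move=> ->.
  by case/setDP=> _ /negPf ->.
(* As [k] fixes [v], the left side does not depend on [k]; comparing [k = h] with the identity
   forces [h] to be trivial, because [Q] is nonzero at [v]. *)
have eval k : k \in G -> rG k *m v = v ->
    \sum_t (e t).@[fun i => v i 0] * (y t).@[fun i => v i 0] =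
    (k == 1%g)%:R * Q.@[fun i => v i 0].
  move=> Gk kv; have := congr1 (meval (fun i => v i 0)) (hy k Gk).
  rewrite rmorphM rmorph_nat /= => <-; rewrite raddf_sum /=;
    apply: eq_bigr => t _.
  rewrite rmorphM /= meval_poly_act; congr (_ * _); apply: meval_eq => i.
  by rewrite -{2}kv mulmxA -repr_mxM ?groupV // mulVg repr_mx1 mul1mx.
have := eval h Gh hv; rewrite (eval 1%g) ?repr_mx1 ?mul1mx ?group1 // eqxx
  mul1r.
have [//|_ /eqP] := eqVneq h 1%g;
  rewrite mul0r rmorph_prod /= => /prodf_eq0[g rg].
by rewrite meval_linear_form => /eqP gv; case/eqP: (hw g rg);
  apply/matrixP => i j; rewrite !ord1 gv mxE.
Qed.

End Freeness.

(** * Fixed points as a trace in two bases *)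

Section TracePermutation.
Variables (F : fieldType) (X T : finType) (A : {set X}).
Variables (U : X -> T -> F) (V : T -> X -> F).
Hypothesis cardT : (#|T| <= #|A|)%N.
Hypothesis UV : {in A &, forall x y, \sum_t U x t * V t y = (x == y)%:R}.

(** The rank of the identity forces [m = n], where one-sided inverses are two-sided. *)
Lemma mulmx1C_leq m n (M : 'M[F]_(m, n)) (N : 'M[F]_(n, m)) :
  (n <= m)%N -> M *m N = 1%:M -> N *m M = 1%:M.
Proof.
move=> nm MN; have mn : (m <= n)%N.
  by rewrite -(mxrank1 F m) -MN (leq_trans (mxrankM_maxl _ _)) ?rank_leq_col.
have E : m = n by apply/eqP; rewrite eqn_leq mn.
by case: n / E M N MN {nm mn} => M N; apply: mulmx1C.
Qed.

Lemma dual_family s t : \sum_(x in A) V s x * U x t = (s == t)%:R.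
Proof.
pose M := \matrix_(i < #|A|, j < #|T|) U (enum_val i) (enum_val j).
pose N := \matrix_(j < #|T|, i < #|A|) V (enum_val j) (enum_val i).
have MN : M *m N = 1%:M.
  apply/matrixP => i j; rewrite !mxE.
  rewrite -(inj_eq enum_val_inj) -UV ?enum_valP //.
  rewrite [RHS](reindex_onto enum_val enum_rank) => [|x _];
    last exact: enum_rankK.
  by apply: eq_big => k; rewrite ?enum_valK ?eqxx // !mxE.
have /matrixP/(_ (enum_rank s) (enum_rank t)) := mulmx1C_leq cardT MN.
rewrite !mxE (inj_eq enum_rank_inj) => <-; rewrite big_enum_val.
by apply: eq_bigr => i _; rewrite !mxE !enum_rankK.
Qed.

(** The trace of composition with [f] on the functions on [A] is computed in the basis of indicator
    functions and in the basis [U], with [V] the dual basis. *)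
Lemma card_fixed_points (f : X -> X) (N : T -> T -> F) :
  {in A, forall x, f x \in A} ->
  {in A, forall x t, U (f x) t = \sum_s U x s * N s t} ->
  #|[set x in A | f x == x]|%:R = \sum_t N t t.
Proof.
move=> fA fU; have -> : #|[set x in A | f x == x]|%:R = \sum_(x in A) (f x ==
  x)%:R :> F.
  rewrite -sum1_card natr_sum [LHS]big_mkcond [RHS]big_mkcond /=.
  by apply: eq_bigr => x _; rewrite inE; case: (x \in A) => //=;
    case: (f x == x).
rewrite (eq_bigr (fun x => \sum_t \sum_s V t x * U x s * N s t)) => [|x Ax];
  last first.
  rewrite -UV ?fA //; apply: eq_bigr => t _; rewrite fU // mulr_suml.
  by apply: eq_bigr => s _; rewrite mulrC mulrA.
rewrite exchange_big; apply: eq_bigr => t _; rewrite exchange_big /=.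
under eq_bigr => s _ do rewrite -mulr_suml dual_family.
rewrite (bigD1 t) //= eqxx mul1r big1 ?addr0 // => s st.
by rewrite eq_sym (negPf st) mul0r.
Qed.

End TracePermutation.

(** * Springer's evaluation on a regular orbit *)

Section Springer.
Variables (C : numClosedFieldType) (gT : finGroupType) (G : {group gT}).
Variables (n : nat) (rG : mx_representation C G n).
Local Notation S := {mpoly C[n]}.
Local Notation act := (poly_act rG).
Local Notation ideal := (coinvariant_ideal rG).

(** Lagrange interpolation: for each other point, a coordinate separating it from [p x] gives one
    factor. *)
Lemma mpoly_interpolation (I : finType) (p : I -> 'cV[C]_n) (A : {set I}) x :
  {in A &, injective p} -> x \in A ->
  exists f : S, forall y, y \in A -> f.@[fun i => p y i 0] = (y == x)%:R.
Proof.
move=> pinj Ax.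
have /choice[f hf] : forall y, exists f : S, y \in A :\ x ->
    f.@[fun i => p y i 0] = 0 /\ f.@[fun i => p x i 0] = 1.
  move=> y; have [/setD1P[yx Ay]|] := boolP (y \in A :\ x); last by exists 0.
  have : p x - p y != 0 by rewrite subr_eq0; apply: contra_neq yx => /pinj ->.
  case/cV0Pn => i; rewrite !mxE => pi.
  exists ((p x i 0 - p y i 0)^-1 *: ('X_i - (p y i 0)%:MP)) => _.
  by rewrite !mevalZ !mevalB !mevalXU !mevalC subrr mulr0 mulVf.
exists (\prod_(y in A :\ x) f y) => y Ay; rewrite rmorph_prod /=.
have [->|yx] := eqVneq y x; first by rewrite big1 // => z /hf[].
have Ay' : y \in A :\ x by rewrite !inE yx.
by rewrite (bigD1 y) //=; have [-> _] := hf y Ay'; rewrite mul0r.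
Qed.

Lemma meval_homog d (f : S) (c : C) (w : 'cV[C]_n) : f \is d.-homog ->
  f.@[fun i => (c *: w) i 0] = c ^+ d * f.@[fun i => w i 0].
Proof.
move=> hf; rewrite !mevalE mulr_sumr big_seq [RHS]big_seq;
  apply: eq_bigr => m mf.
rewrite mulrCA; congr (_ * _);
  rewrite -(dhomog_mf hf mf) /= mdegE -prodrXr -big_split.
by apply: eq_bigr => i _; rewrite mxE exprMn.
Qed.

Hypothesis hG : complex_reflection_group rG.
Variables (T : finType) (deg : T -> nat) (e : T -> S).
Hypothesis he : graded_basis rG deg e.
Variables (v : 'cV[C]_n) (c : gT) (omega : C).
Hypotheses (vreg : regular_vector rG v) (Gc : c \in G).
Hypothesis cv : rG c *m v = omega *: v.

Local Notation point x := (fun i => (rG x *m v) i 0).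

Lemma orbit_map_inj : {in G &, injective (fun x => rG x *m v)}.
Proof.
move=> x y Gx Gy xy; apply/eqP; rewrite eq_mulVg1; apply/eqP.
apply: (regular_vector_free hG he vreg); rewrite ?groupM ?groupV //.
by rewrite repr_mxM ?groupV // -mulmxA -xy mulmxA -repr_mxM ?groupV // mulVg
  repr_mx1 mul1mx.
Qed.

Lemma regular_power (a : nat) : rG (c ^+ a)%g *m v = omega ^+ a *: v.
Proof.
elim: a => [|a IH]; first by rewrite expg0 repr_mx1 mul1mx expr0 scale1r.
by rewrite expgSr repr_mxM ?groupX // -mulmxA cv -scalemxAr IH scalerA exprS.
Qed.

(* Evaluation on the regular orbit [G v] identifies the coinvariant algebra with
   the functions on [G]; multiplication of [v] by [omega] becomes right
   translation by [c], and the error terms of the action of [g], lying in the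
   ideal, only involve basis elements of lower degree. *)
Lemma springer_fixed_points (g : gT) (N : T -> T -> C) (a : nat) : g \in G ->
  (forall s t, deg s != deg t -> N s t = 0) ->
  (forall t, ideal (act g (e t) - \sum_s N s t *: e s)) ->
  #|[set x in G | (g^-1 * x * c ^+ a)%g == x]|%:R =
  \sum_t omega ^+ (a * deg t) * N t t.
Proof.
move=> Gg N0 hN; have [hom efree _] := he.
(* The interpolating polynomial at [x] is expanded in the [e t]; its invariant coefficients are
   constant on the orbit, so their values at [v] serve as [V]. *)
have /choice[V hV] : forall x, exists r : T -> C, x \in G -> forall y, y \in G
  ->
    \sum_t (e t).@[point y] * r t = (y == x)%:R.
  move=> x; have [Gx|] := boolP (x \in G); last by exists (fun=> 0).
  have [f hf] := mpoly_interpolation orbit_map_inj Gx.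
  have [r [hr fE]] := invariant_combination he f.
  exists (fun t => (r t).@[point 1%g]) => _ y Gy;
    rewrite -hf // fE raddf_sum /=.
  apply: eq_bigr => t _; rewrite mulrC rmorphM /=; congr (_ * _).
  rewrite -{1}(hr t y^-1%g) ?groupV // meval_poly_act; apply: meval_eq => i.
  by rewrite invgK repr_mx1 mul1mx.
(* The error terms involve only degrees below [deg t], so they do not reach the diagonal of [N']. *)
have /choice[r hr] : forall t, exists r : T -> S,
    [/\ forall s, invariant rG (r s), forall s, (deg t <= deg s)%N -> r s = 0
      & act g (e t) - \sum_s N s t *: e s = \sum_s r s * e s].
  move=> t; apply: (ideal_spanned he) (hN t).
  apply: rpredB; first exact: dhomog_poly_act.
  apply: rpred_sum => s _; have [<-|/N0 ->] := eqVneq (deg s) (deg t).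
    exact/rpredZ/hom.
  by rewrite scale0r rpred0.
pose N' s t := omega ^+ (a * deg t) * (N s t + (r t s).@[point 1%g]).
have -> : \sum_t omega ^+ (a * deg t) * N t t = \sum_t N' t t.
  apply: eq_bigr => t _; have [_ r0 _] := hr t.
  by rewrite /N' r0 // meval0 addr0.
apply: (@card_fixed_points _ _ _ G (fun x t => (e t).@[point x]) (fun t x => V
  x t)).
- exact: (ideal_free_card hG efree).
- by move=> x y Gx Gy; rewrite /= hV.
- by move=> x Gx; rewrite !groupM ?groupV ?groupX.
move=> x Gx t /=.
(* The point is [omega ^+ a] times the image of [v] under [g^-1 * x]; homogeneity extracts the
   scalar. *)
have -> : (e t).@[point (g^-1 * x * c ^+ a)%g] =
    omega ^+ (a * deg t) * (act g (e t)).@[point x].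
  rewrite meval_poly_act exprM -(meval_homog _ _ (hom t)); apply: meval_eq => i.
  by rewrite repr_mxM ?groupM ?groupV ?groupX // -mulmxA regular_power
    -scalemxAr repr_mxM ?groupV // mulmxA.
have [inv _ /eqP] := hr t; rewrite subr_eq => /eqP ->.
rewrite -big_split raddf_sum mulr_sumr /=; apply: eq_bigr => s _.
have rE : (r t s).@[point x] = (r t s).@[point 1%g].
  rewrite -{2}(inv s x^-1%g) ?groupV // meval_poly_act; apply: meval_eq => i.
  by rewrite invgK repr_mx1 mul1mx.
by rewrite mevalD mevalZ mevalM rE /N'; ring.
Qed.

End Springer.

(** * Fake degrees at inverse powers of regular eigenvalues *)

Section FakeDegree.
Variables (C : numClosedFieldType) (gT : finGroupType) (G : {group gT}).
Variables (n : nat) (rG : mx_representation C G n).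
Local Notation S := {mpoly C[n]}.
Local Notation act := (poly_act rG).
Local Notation ideal := (coinvariant_ideal rG).

Hypothesis hG : complex_reflection_group rG.

(** The set under [xget] is nonempty, so the value is the trace in some basis, which may vary with
    [d] and [g]. *)
Lemma coinvariant_charP d g : exists k (e : 'I_k -> S) (M : 'M[C]_k),
  [/\ coinvariant_basis rG d e,
      forall j, ideal (act g (e j) - \sum_(i < k) M i j *: e i)
    & coinvariant_char rG d g = \tr M].
Proof.
suff [k [M [[e he hM] trM]]] : exists (k : nat) (M : 'M[C]_k),
    coinvariant_matrix rG d g M /\ coinvariant_char rG d g = \tr M.
  by exists k, e, M.
apply: (xgetPex 0 (P := [set x | exists (k : nat) (M : 'M[C]_k),
            coinvariant_matrix rG d g M /\ x = \tr M]%classic)).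
have [k [e he]] := coinvariant_basis_exists hG d; have [hom _ dec] := he.
have [M hM] := choice (fun j => dec _ (dhomog_poly_act rG g (hom j))).
exists (\tr (\matrix_(i, j) M j i)), k, (\matrix_(i, j) M j i); split=> //.
exists e => // j; have := hM j; congr (ideal (_ - _)).
by apply: eq_bigr => i _; rewrite mxE.
Qed.

Definition above_top D := forall d f, (D <= d)%N -> f \is d.-homog -> ideal f.

Lemma coinvariant_char_top D d g :
  above_top D -> (D <= d)%N -> coinvariant_char rG d g = 0.
Proof.
move=> topD Dd; have [k [e [M [[hom efree _] _ ->]]]] := coinvariant_charP d g.
case: k e M hom efree => [|k] e M hom efree; first by rewrite /mxtrace big_ord0.
have := efree (fun i => (i == ord0)%:R) _ ord0; rewrite eqxx => E.
suff /E /eqP : ideal (\sum_i (i == ord0)%:R *: e i) by rewrite oner_eq0.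
by apply: coinvariant_ideal_sum => i _; apply/coinvariant_idealZ/(topD d).
Qed.

Lemma fake_degreeE D chi : above_top D ->
  fake_degree rG chi = \poly_(d < D) char_inner G chi (coinvariant_char rG d).
Proof.
move=> topD; set q := \poly_(d < D) _.
have hq d : q`_d = char_inner G chi (coinvariant_char rG d).
  rewrite coef_poly; case: ltnP => // Dd;
    rewrite /char_inner big1 ?mulr0 // => g _.
  by rewrite (coinvariant_char_top g topD Dd) rmorph0 mulr0.
have hp : [set p : {poly C} | forall d, p`_d = char_inner G chi
  (coinvariant_char rG d)]%classic
    (fake_degree rG chi) := xgetPex 0 (ex_intro _ q hq).
by apply/polyP => d; rewrite hq; apply: hp.
Qed.

Variables (v : 'cV[C]_n) (c : gT) (omega : C).
Hypotheses (v0 : v != 0) (vreg : regular_vector rG v) (Gc : c \in G).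
Hypothesis cv : rG c *m v = omega *: v.

(** Springer's graded trace formula, in bases chosen for the given [g], where the matrix [N] is
    block diagonal. *)
Lemma sum_coinvariant_char D g a : above_top D -> g \in G ->
  \sum_(d < D) omega ^+ (a * d) * coinvariant_char rG d g =
  #|[set x in G | (g^-1 * x * c ^+ a)%g == x]|%:R.
Proof.
move=> topD Gg.
have [K hK] := choice (fun d => coinvariant_charP d g).
pose e d := projT1 (cid (hK d)); have he d := projT2 (cid (hK d)).
pose M d := projT1 (cid (he d)); have hM d := projT2 (cid (he d)).
have hB d : coinvariant_basis rG d (e d) by have [] := hM d.
(* [insub] carries the index of [s] to the block of [t] without a cast; within one degree it always
   succeeds. *)
pose N (s t : basis_index K D) : C :=
  if insub (tagged s : nat) is Some i then
    (tag s == tag t)%:R * M (tag t) i (tagged t) else 0.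
rewrite (springer_fixed_points hG (full_basis_graded hB topD) vreg Gc cv (N :=
  N)) //.
- rewrite sum_basis_index; apply: eq_bigr => d _; have [_ _ ->] := hM d.
  rewrite mulr_sumr; apply: eq_bigr => i _.
  by rewrite /N /= valK eqxx mul1r.
- move=> s t; rewrite val_eqE => /negPf st; rewrite /N;
  case: insubP => // i _ _.
  by rewrite st mul0r.
case=> d i; have [_ /(_ i) + _] := hM d; congr (ideal (_ - _)).
rewrite sum_basis_index (bigD1 d) //= [X in _ + X]big1 ?addr0 => [|d' /negPf
  d'd].
  by apply: eq_bigr => j _; rewrite /N /= valK eqxx mul1r.
rewrite big1 // => j _; rewrite /N /=; case: insubP => [k _ _|];
  last by rewrite scale0r.
by rewrite d'd mul0r scale0r.
Qed.

Lemma regular_eigenvalue_unity : omega ^+ #[c]%g = 1.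
Proof.
have := regular_power Gc cv #[c]%g; rewrite expg_order repr_mx1 mul1mx.
move/eqP; rewrite -subr_eq0 -{1}[v]scale1r -scalerBl scaler_eq0 (negPf v0) orbF.
by rewrite subr_eq0 => /eqP.
Qed.

Lemma conj_unity_root (z : C) k : (0 < k)%N -> z ^+ k = 1 -> z^* = z^-1.
Proof.
move=> k0 zk; have z1 : `|z| = 1.
  by apply: (@pexpIrn _ k);
    rewrite ?nnegrE ?normr_ge0 // -normrX zk normr1 expr1n.
by rewrite -[z^-1]mul1r -(expr1n _ 2) -z1 normCK mulrAC divff ?mul1r //
  -normr_eq0 z1 oner_eq0.
Qed.

(** Class functions cover both the Galois and the complex conjugates of a character. Conjugation in
    the inner product inverts [omega ^+ a], and counting fixed points turns the sum over [g] into
    one over the conjugates of [c ^+ a]. *)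
Lemma fake_degree_regular (chi : gT -> C) a :
  {in G &, forall x y, chi (x ^ y)%g = chi x} ->
  (fake_degree rG chi).[(omega ^+ a)^-1] = chi (c ^+ a)%g.
Proof.
move=> class_chi; have [D topD] := coinvariant_top_degree hG.
have conj_om : (omega ^+ a)^-1 = (omega ^+ a)^*.
  by rewrite rmorphXn /= (conj_unity_root _ regular_eigenvalue_unity)
    ?order_gt0 // exprVn.
rewrite (fake_degreeE chi topD) horner_poly.
have -> : \sum_(d < D) char_inner G chi (coinvariant_char rG d) * (omega ^+
  a)^-1 ^+ d =
    #|G|%:R^-1 * \sum_(g in G) chi g * #|[set x in G | (g^-1 * x * c ^+ a)%g ==
      x]|%:R.
  under eq_bigr => d _ do rewrite /char_inner -mulrA mulr_suml.
  rewrite -mulr_sumr exchange_big; congr (_ * _); apply: eq_bigr => g Gg /=.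
  rewrite -[X in _ * X]conjC_nat -(sum_coinvariant_char a topD Gg).
  rewrite rmorph_sum mulr_sumr; apply: eq_bigr => d _.
  by rewrite rmorphM /= exprM rmorphXn /= -conj_om mulrAC mulrA.
have fixE g : #|[set x in G | (g^-1 * x * c ^+ a)%g == x]|%:R =
    \sum_(x in G) (g == (c ^+ a) ^ x^-1)%g%:R :> C.
  rewrite -sum1_card natr_sum [LHS]big_mkcond [RHS]big_mkcond /=.
  apply: eq_bigr => x _; rewrite inE; case: (x \in G) => //=.
  suff -> : (g^-1 * x * c ^+ a == x)%g = (g == (c ^+ a) ^ x^-1)%g by case: eqP.
  rewrite conjgE invgK; apply/eqP/eqP => [E|->].
    have -> : (x * (c ^+ a * x^-1) = g * (g^-1 * x * c ^+ a) * x^-1)%g.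
      by rewrite !mulgA mulgV mul1g.
    by rewrite E mulgK.
  by rewrite !invMg invgK !mulgKV.
under eq_bigr => g _ do rewrite fixE mulr_sumr.
rewrite exchange_big /= (eq_bigr (fun=> chi (c ^+ a)%g)) => [|x Gx].
  by rewrite sumr_const -[X in _ * X]mulr_natl mulKf ?natr_cardG_neq0.
have Gcx : ((c ^+ a) ^ x^-1)%g \in G by rewrite groupJ ?groupV ?groupX.
rewrite (bigD1 ((c ^+ a) ^ x^-1)%g) //= eqxx mulr1 big1 => [|g /andP[_ /negPf
  ->]].
  by rewrite addr0 class_chi ?groupV ?groupX.
by rewrite mulr0.
Qed.

End FakeDegree.

(** * Matrix coefficients and the second orthogonality relation *)

Section IrreducibleCharacters.
Variables (C : numClosedFieldType) (gT : finGroupType) (G : {group gT}).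
Local Notation sG := (irr_index C G).
Local Notation aG := (regular_repr C G).

Lemma num_pchar'_group : [pchar C]^'.-group G.
Proof. by apply/pgroupP => p _; rewrite inE /= pchar_num. Qed.

Lemma closed_splitting : group_splitting_field C G.
Proof. exact: group_closure_closed_field. Qed.

(** The group ring element [A] acts as zero in every irreducible representation, each of which is
    injective on its Wedderburn component; so all components of [A] vanish. *)
Lemma irr_repr_free (a : gT -> C) :
  (forall l : sG, \sum_(x in G) a x *: irr_repr l x = 0) ->
  {in G, forall x, a x = 0}.
Proof.
move=> irr0; pose A := \sum_(x in G) a x *: aG x.
have opA n (rG : mx_representation C G n) :
    gring_op rG A = \sum_(x in G) a x *: rG x.
  by rewrite linear_sum; apply: eq_bigr => x Gx; rewrite linearZ /= gring_opG.
have RA : (A \in group_ring C G)%MS.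
  rewrite linear_sum; apply: summx_sub => x Gx /=.
  by rewrite linearZ /= scalemx_sub ?envelop_mx_id.
have A0 : A = 0.
  rewrite -[A]mulmx1 -(Wedderburn_sum_id_pchar sG num_pchar'_group) mulmx_sumr.
  apply: big1 => l _.
  have Rl := Wedderburn_id_mem l; have [idl _] := andP (Wedderburn_ideal l).
  have RAe : (A *m Wedderburn_id l \in Wedderburn_subring l)%MS.
    by apply: submx_trans idl; apply: mem_mulsmx.
  have := regular_op_inj_pchar (sG := sG) num_pchar'_group (socle_irr l).
  rewrite (irr_reprK_pchar num_pchar'_group) => inj.
  apply: inj; rewrite ?inE ?linear0 ?sub0mx //.
  rewrite gring_opM ?opA ?irr0 ?mul0mx // -(Wedderburn_sum_pchar sG
    num_pchar'_group).
  by rewrite (sumsmx_sup l).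
move=> x Gx.
have := congr1 (gring_proj x) A0; rewrite linear0 linear_sum (bigD1 x) //=.
rewrite linearZ /= gring_projE // eqxx big1 => [|y /andP[Gy yx]]; last first.
  by rewrite linearZ /= gring_projE // eq_sym (negPf yx) scaler0.
by rewrite addr0 => /matrixP/(_ 0 0); rewrite !mxE mulr1.
Qed.

Definition coef_index := {l : sG & 'I_(irr_degree l) * 'I_(irr_degree l)}%type.
Definition coef_fun (x : gT) (t : coef_index) : C :=
  irr_repr (tag t) x (tagged t).1 (tagged t).2.

Definition coef_pack l (p q : 'I_(irr_degree l)) : coef_index :=
  @Tagged _ l (fun l : sG => 'I_(irr_degree l) * 'I_(irr_degree l))%type (p, q).

Lemma sum_coef_index (F : coef_index -> C) :
  \sum_t F t = \sum_(l : sG) \sum_p \sum_q F (@coef_pack l p q).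
Proof.
under [RHS]eq_bigr => l _ do rewrite pair_bigA.
by rewrite sig_big_dep; apply: eq_bigr => [[l [p q]]].
Qed.

Lemma card_coef_index : #|{: coef_index}| = #|G|.
Proof.
rewrite -(sum_irr_degree_pchar sG num_pchar'_group closed_splitting).
rewrite card_tagged sumnE big_map big_enum; apply: eq_bigr => l _ /=.
by rewrite card_prod !card_ord.
Qed.

(** The rows of [M] are independent by [irr_repr_free], so [M] has a right inverse, from which [V]
    is read off. *)
Lemma coef_fun_dual : exists V : coef_index -> gT -> C,
  {in G &, forall x y, \sum_t coef_fun x t * V t y = (x == y)%:R}.
Proof.
pose M := \matrix_(i < #|G|, j < #|{: coef_index}|) coef_fun (enum_val i)
  (enum_val j).
have Mfree : kermx M = 0.
  apply/eqP/rowV0P => u /sub_kermxP uM; apply/rowP => i; rewrite mxE.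
  (* One term for [x] in [G] and none outside, so this extends [u] by zero. *)
  pose a x := \sum_(k | enum_val k == x) u 0 k.
  have aE k : a (enum_val k) = u 0 k.
    by rewrite /a (big_pred1 k) // => j; rewrite (inj_eq enum_val_inj).
  rewrite -aE; apply: irr_repr_free (enum_valP i) => l.
  apply/matrixP => p q; rewrite summxE mxE big_enum_val /=.
  have /rowP/(_ (enum_rank (coef_pack p q))) := uM; rewrite !mxE; apply: etrans.
  by apply: eq_bigr => k _; rewrite mxE aE [M _ _]mxE enum_rankK.
have /row_freeP[N MN] : row_free M by rewrite -kermx_eq0 Mfree.
exists (fun t y => \sum_(k | enum_val k == y) N (enum_rank t) k) => x y Gx Gy.
pose i := enum_rank_in Gx x; pose j := enum_rank_in Gy y.
have xi : enum_val i = x by rewrite enum_rankK_in.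
have yj : enum_val j = y by rewrite enum_rankK_in.
have <- : 1%:M i j = (x == y)%:R :> C by rewrite mxE -xi -yj (inj_eq
  enum_val_inj).
rewrite -MN mxE (reindex_onto enum_val enum_rank) => [|t _] /=;
  last exact: enum_rankK.
apply: eq_big => k; first by rewrite enum_valK eqxx.
move=> _; rewrite mxE xi enum_valK; congr (_ * _).
by rewrite (big_pred1 j) // => l; rewrite -yj (inj_eq enum_val_inj).
Qed.

(** The trace of the map [x |-> a * x * b^-1] on functions on [G], taken in the basis of matrix
    coefficients; expanding the product of three matrices splits it into products of two traces. *)
Lemma second_orthogonality a b : a \in G -> b \in G ->
  \sum_(l : sG) irr_char l a * irr_char l b^-1%g =
  #|[set x in G | (a * x * b^-1)%g == x]|%:R.
Proof.
move=> Ga Gb; have [V hV] := coef_fun_dual.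
pose N (s t : coef_index) : C :=
  if insub ((tagged s).1 : nat) is Some p then
    if insub ((tagged s).2 : nat) is Some q then
      (tag s == tag t)%:R * irr_repr (tag t) a (tagged t).1 p * irr_repr (tag
        t) b^-1%g q (tagged t).2
    else 0
  else 0.
rewrite (@card_fixed_points _ _ _ G coef_fun V _ hV _ N); first last.
- move=> x Gx [l [p q]]; rewrite sum_coef_index (bigD1 l) //=.
  rewrite [X in _ = _ + X]big1 ?addr0 => [|l' /negPf l'l]; last first.
    rewrite big1 // => p' _; rewrite big1 // => q' _; rewrite /N /=.
    case: insubP => [? _ _|]; last by rewrite mulr0.
    by case: insubP => [? _ _|]; rewrite ?l'l ?mul0r mulr0.
  rewrite /coef_fun /= !repr_mxM ?groupM ?groupV // mxE exchange_big /=.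
  apply: eq_bigr => q' _; rewrite mxE mulr_suml; apply: eq_bigr => p' _.
  by rewrite /N /= !valK eqxx mul1r; ring.
- by move=> x Gx; rewrite !groupM ?groupV.
- by rewrite card_coef_index.
rewrite sum_coef_index; apply: eq_bigr => l _; rewrite /irr_char /mxtrace.
rewrite mulr_suml; apply: eq_bigr => p _; rewrite mulr_sumr;
  apply: eq_bigr => q _.
by rewrite /N /= !valK eqxx mul1r.
Qed.

End IrreducibleCharacters.

(** * Character values at powers of an element *)

Section CharacterPowers.
Variables (C : numClosedFieldType) (gT : finGroupType) (G : {group gT}).

Lemma unity_root_neq0 N (z : C) : (0 < N)%N -> z ^+ N = 1 -> z != 0.
Proof.
by move=> N0 zN; apply: contra_eq_neq zN => ->;
  rewrite expr0n gtn_eqF // eq_sym oner_neq0.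
Qed.

Lemma character_powers n (rG : mx_representation C G n) g m (z : C) :
  m.-primitive_root z -> g \in G -> (g ^+ m)%g = 1%g ->
  exists k : 'I_n -> nat, forall a, \tr (rG (g ^+ a)%g) = \sum_i z ^+ (k i * a).
Proof.
case: n rG => [|n] rG zprim Gg gm.
  by exists (fun=> 0%N) => a; rewrite /mxtrace !big_ord0.
pose A := rG g.
have rGX a : rG (g ^+ a)%g = A ^+ a by rewrite repr_mxX.
have [P Pu /diagonalizable_forPex[d /(simmxP Pu) PA]] : diagonalizable A.
  apply/diagonalizableP; exists [seq z ^+ i | i <- index_iota 0 m].
    rewrite map_inj_in_uniq ?iota_uniq // => i j.
    rewrite !mem_index_iota /= => im jm /eqP.
    by rewrite (eq_prim_root_expr zprim) !modn_small // => /eqP.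
  rewrite big_map factor_Xn_sub_1 //; apply: mxminpoly_min.
  by rewrite rmorphB rmorphXn /= horner_mx_X horner_mx_C -rGX gm repr_mx1 subrr.
have PX a : P *m A ^+ a = diag_mx (\row_i d 0 i ^+ a) *m P.
  elim: a => [|a IH].
    rewrite expr0 mulmx1 (_ : diag_mx _ = 1%:M) ?mul1mx //.
    by apply/matrixP => i j; rewrite !mxE expr0.
  rewrite exprSr mulmxA IH -mulmxA PA mulmxA mulmx_diag; congr (diag_mx _ *m P).
  by apply/rowP => i; rewrite !mxE exprSr.
have trX a : \tr (A ^+ a) = \sum_i d 0 i ^+ a.
  rewrite -[A ^+ a](mulKmx Pu) PX mxtrace_mulC mulmxK // mxtrace_diag.
  by apply: eq_bigr => i _; rewrite mxE.
have /choice[k hk] : forall i, exists k, d 0 i = z ^+ k.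
  move=> i; have : d 0 i ^+ m = 1.
    have := PX m; rewrite -rGX gm repr_mx1 mulmx1 -{1}[P]mul1mx.
    move/(canRL (mulmxK Pu)); rewrite mulmxK // => /matrixP/(_ i i).
    by rewrite !mxE eqxx.
  by move/(prim_rootP zprim) => [k ->]; exists k.
exists k => a; rewrite rGX trX; apply: eq_bigr => i _.
by rewrite hk exprM.
Qed.

Lemma irr_char_class (l : irr_index C G) :
  {in G &, forall x y, irr_char l (x ^ y)%g = irr_char l x}.
Proof.
move=> x y Gx Gy; rewrite /irr_char conjgE !repr_mxM ?groupM ?groupV //.
by rewrite mxtrace_mulC -mulmxA -repr_mxM ?groupV // mulgV repr_mx1 mulmx1.
Qed.

(** Eigenvalues of [g] are roots of unity, for which inversion is complex conjugation. *)
Lemma irr_char_inv (l : irr_index C G) g (z : C) a :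
  #[g]%g.-primitive_root z -> g \in G ->
  irr_char l (g ^- a)%g = (irr_char l (g ^+ a)%g)^*.
Proof.
move=> zprim Gg.
have [k hk] := character_powers (irr_repr l) zprim Gg (expg_order g).
have -> : (g ^- a = g ^+ (#[g] * a - a))%g.
  apply/eqP; rewrite eq_invg_mul -expgD subnKC ?leq_pmull ?order_gt0 //.
  by rewrite expgM expg_order expg1n.
rewrite /irr_char !hk rmorph_sum; apply: eq_bigr => i _ /=.
have z0 := unity_root_neq0 (order_gt0 g) (prim_expr_order zprim).
rewrite rmorphXn /= (conj_unity_root (order_gt0 g) (prim_expr_order zprim))
  exprVn.
apply: (mulIf (expf_neq0 (k i * a) z0)); rewrite mulVf ?expf_neq0 // -exprD.
rewrite -mulnDr subnK ?leq_pmull ?order_gt0 //.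
by rewrite mulnCA exprM (prim_expr_order zprim) expr1n.
Qed.

(** One natural exponent congruent to [k] modulo [N] serves for group elements and for roots of
    unity alike. *)
Lemma expz_nat N (k : int) : (0 < N)%N -> exists b : nat,
  (forall (hT : finGroupType) (y : hT), (y ^+ N)%g = 1%g -> expgz y k = (y ^+
    b)%g) /\
  (forall z : C, z ^+ N = 1 -> z ^ k = z ^+ b).
Proof.
case: k => k N0; first by exists k.
(* [Negz k] stands for [- k.+1], to which a multiple of [N] is added. *)
exists (N * k.+1 - k.+1)%N; have le : (k.+1 <= N * k.+1)%N by rewrite leq_pmull.
split=> [hT y yN|z zN].
  by apply/eqP; rewrite /= eq_invg_mul -expgD subnKC // expgM yN expg1n.
have z0 := unity_root_neq0 N0 zN.
rewrite NegzE -exprnN; apply: (mulIf (expf_neq0 k.+1 z0)).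
by rewrite mulVf ?expf_neq0 // -exprD subnK // exprM zN expr1n.
Qed.

End CharacterPowers.

(** * Galois automorphisms on sums and powers *)

Section GaloisPowers.
Variables (C : numClosedFieldType) (zeta : C) (sigma : C -> C).
Hypothesis hsigma : galois_automorphism zeta sigma.
Local Notation K := (rat_adjoin zeta).

Lemma rat_adjoinX k : K (zeta ^+ k).
Proof. by exists 'X^k; rewrite map_polyXn hornerXn. Qed.

Lemma rat_adjoinD x y : K x -> K y -> K (x + y).
Proof. by move=> [p ->] [q ->]; exists (p + q); rewrite rmorphD hornerD. Qed.

Lemma rat_adjoin0 : K 0.
Proof. by exists 0; rewrite rmorph0 horner0. Qed.

Lemma galois_sum (I : finType) (F : I -> C) : (forall i, K (F i)) ->
  sigma (\sum_i F i) = \sum_i sigma (F i).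
Proof.
move=> KF; have [_ _ sD _] := hsigma.
have s0 : sigma 0 = 0.
  have K0 : 0 \in K by rewrite in_setE; apply: rat_adjoin0.
  by have := sD 0 0 K0 K0; rewrite addr0 => /eqP;
    rewrite -subr_eq0 opprD addNKr oppr_eq0 => /eqP.
(* Additivity is given only on [Q[zeta]], so membership is carried along the induction. *)
suff [] : K (\sum_i F i) /\ sigma (\sum_i F i) = \sum_i sigma (F i) by [].
elim/big_ind2: _ => [|x y x' y' [Kx sx] [Kx' sx']|i _].
- by split; first exact: rat_adjoin0.
- by split; [exact: rat_adjoinD|rewrite sD ?in_setE // sx sx'].
- by split.
Qed.

Lemma galoisX k a : sigma (zeta ^+ k ^+ a) = sigma (zeta ^+ k) ^+ a.
Proof.
have [_ s1 _ sM] := hsigma; elim: a => [|a IH]; first by rewrite !expr0.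
rewrite !exprS sM ?IH // in_setE; first exact: rat_adjoinX.
by rewrite -exprM; apply: rat_adjoinX.
Qed.

End GaloisPowers.

(** * The order of a regular eigenvalue *)

Section RegularOrder.
Variables (C : numClosedFieldType) (gT : finGroupType) (G : {group gT}).
Variables (n : nat) (rG : mx_representation C G n).

(** If [omega ^+ m = 1], then [c ^+ m] fixes the regular vector, hence is trivial by Steinberg's
    theorem. *)
Lemma regular_eigenvalue_primitive c (omega : C) :
  complex_reflection_group rG -> c \in G -> regular_eigenvalue rG c omega ->
  #[c]%g.-primitive_root omega.
Proof.
move=> hG Gc [v [v0 vreg cv]].
have [m om mc] := prim_order_exists (order_gt0 c) (regular_eigenvalue_unity v0
  Gc cv).
have cm : (c ^+ m)%g = 1%g.
  have [T [deg [e he]]] := graded_basis_exists hG.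
  apply: (regular_vector_free hG he vreg); first by rewrite groupX.
  by rewrite (regular_power Gc cv) (prim_expr_order om) scale1r.
suff -> : #[c]%g = m by [].
by apply/eqP; rewrite eqn_dvd mc andbT order_dvdn cm.
Qed.

End RegularOrder.

Theorem theorem1p4 (R : realType) (gT : finGroupType) (G : {group gT})
    (n : nat) (rG : mx_representation R[i] G n)
    (hG : complex_reflection_group rG)
    (zeta : R[i]) (hzeta : (exponent G).-primitive_root zeta)
    (sigma : R[i] -> R[i]) (hsigma : galois_automorphism zeta sigma)
    (c c' : gT) (hc : c \in G) (hc' : c' \in G)
    (omega omega' : R[i])
    (homega : regular_eigenvalue rG c omega)
    (homega' : regular_eigenvalue rG c' omega')
    (s : int) (hs : sigma omega = omega ^ s)
    (i j : int) :
  bimahonian rG sigma (omega ^ (- i)) (omega' ^ (- j)) =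
  #|[set w in G | twisted_act s (expgz c i, expgz c' j) w == w]|%:R.
Proof.
have om := regular_eigenvalue_primitive hG hc homega.
have om' := regular_eigenvalue_primitive hG hc' homega'.
have [v [v0 vreg cv]] := homega; have [v' [v0' vreg' cv']] := homega'.
(* Natural exponents [a], [a'] and [b] replace [i], [j] and [s]. *)
have [a [/(_ _ c (expg_order c)) ca /(_ _ (prim_expr_order om)) oma]] :=
  @expz_nat R[i] _ i (order_gt0 c).
have [a' [/(_ _ c' (expg_order c')) ca' /(_ _ (prim_expr_order om')) oma']] :=
  @expz_nat R[i] _ j (order_gt0 c').
have [b [/(_ _ (c ^+ a)%g) cb /(_ _ (prim_expr_order om)) omb]] :=
  @expz_nat R[i] _ s (order_gt0 c).
have {}cb : expgz (c ^+ a)%g s = (c ^+ a ^+ b)%g.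
  by apply: cb; rewrite -expgM mulnC expgM expg_order expg1n.
(* The eigenvalues of [c] are powers of [omega], and [sigma] raises each of them to the power [s];
   so the value at [c ^+ a] goes to the value at its power [b]. *)
have sigma_char (l : irr_index R[i] G) :
    sigma (irr_char l (c ^+ a)%g) = irr_char l (c ^+ a ^+ b)%g.
  (* The order of [c] divides the exponent of [G], which places [omega] in [Q[zeta]]. *)
  have [r omr] : exists r, omega = zeta ^+ r.
    have : omega ^+ exponent G = 1.
      by have /dvdnP[q ->] := dvdn_exponent hc;
        rewrite mulnC exprM (prim_expr_order om) expr1n.
    by move/(prim_rootP hzeta) => [r ->]; exists r.
  have [k hk] := character_powers (irr_repr l) om hc (expg_order c).
  have charE d : irr_char l (c ^+ d)%g = \sum_t omega ^+ (k t * d) := hk d.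
  rewrite -(expgM c a b) (charE a) (charE (a * b)%N) (galois_sum hsigma) =>
    [|t]; last first.
    by rewrite omr -exprM; apply: rat_adjoinX.
  apply: eq_bigr => t _; rewrite {1}omr (galoisX hsigma) -omr hs omb.
  by rewrite -exprM; congr (_ ^+ _); lia.
rewrite /bimahonian -!invr_expz oma oma'.
under eq_bigr => l _.
  rewrite (fake_degree_regular hG v0 vreg hc cv) => [|x y Gx Gy]; last first.
    by rewrite irr_char_class.
  rewrite (fake_degree_regular hG v0' vreg' hc' cv') => [|x y Gx Gy];
    last first.
    by rewrite irr_char_class.
  (* The conjugate of the character at [c' ^+ a'] is its value at the inverse, as the orthogonality
     relation requires. *)
  rewrite sigma_char -(irr_char_inv l a' om' hc').
  over.
rewrite second_orthogonality ?groupX //; congr (_%:R); apply: eq_card => w.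
by rewrite !inE /twisted_act /= ca ca' cb.
Qed.
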